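(* Let $\mathcal M$ be the configuration space of ordered quadruples of distinct points of $\partial\mathbf{H}^2_{\mathbb C}$ modulo the diagonal action of $\mathrm{PU}(2,1)$, with the quotient topology. Then the map $\tau:\mathcal M\to\mathbb C^2\times\mathbb R$, $$\tau:[p_1,p_2,p_3,p_4]\mapsto \bigl(X_1,X_2,\mathbb A\bigr)=\bigl(X(p_1,p_2,p_3,p_4),\,X(p_1,p_3,p_2,p_4),\,\mathbb A(p_1,p_2,p_3)\bigr),$$ is a homeomorphism onto the set $\mathbb M$ of points $(X_1,X_2,A)\in\mathbb C_*^2\times\mathbb R$ (with $\mathbb C_*=\mathbb C\setminus\{0\}$, and $\mathbb M$ carrying the subspace topology from $\mathbb C^2\times\mathbb R$) satisfying $$-2\,\mathrm{Re}(X_1+X_2)-2\,\mathrm{Re}\bigl(X_1\overline{X}_2e^{-2iA}\bigr)+|X_1|^2+|X_2|^2+1=0,$$ $$-\pi/2\le A\le\pi/2,\qquad \mathrm{Re}(X_1e^{-iA})\ge 0.$$ In particular $\mathcal M$ is homeomorphic to $\mathbb M$.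
   Context: Let $\mathbb C^{n,1}$ denote $\mathbb C^{n+1}$ with the Hermitian form $\langle Z,W\rangle=z_1\overline{w}_{n+1}+z_2\overline{w}_2+\cdots+z_n\overline{w}_n+z_{n+1}\overline{w}_1$ of signature $(n,1)$. Complex hyperbolic space $\mathbf H^n_{\mathbb C}$ is the set of negative lines ($\langle Z,Z\rangle<0$) in $\mathbb P\mathbb C^n$; its boundary $\partial\mathbf H^n_{\mathbb C}$ is the set of isotropic (null) lines ($\langle Z,Z\rangle=0$, $Z\neq0$). $\mathrm{PU}(n,1)$ (projectivized unitary group of the form) is the holomorphic isometry group and acts on $\partial\mathbf H^n_{\mathbb C}$. A lift of a boundary point $p$ is a nonzero null vector $P$ representing it. For an ordered quadruple of distinct boundary points with lifts $P_i$, the Korányi–Reimann complex cross-ratio is $X(p_1,p_2,p_3,p_4)=\dfrac{\langle P_3,P_1\rangle\langle P_4,P_2\rangle}{\langle P_4,P_1\rangle\langle P_3,P_2\rangle}$ (independent of lifts). For an ordered triple of distinct boundary points, Cartan's angular invariant is $\mathbb A(p_1,p_2,p_3)=\arg\bigl(-\langle P_1,P_2\rangle\langle P_2,P_3\rangle\langle P_3,P_1\rangle\bigr)\in[-\pi/2,\pi/2]$. Here $n=2$. *)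

(* Defs.v *)
From HB Require Import structures.
From mathcomp Require Import all_boot all_order all_algebra.
From mathcomp Require Import all_classical all_reals all_analysis.
From mathcomp Require Import complex generic_quotient.
Import Order.TTheory GRing.Theory Num.Theory.
Import numFieldTopology.Exports.

Set Implicit Arguments.
Unset Strict Implicit.
Unset Printing Implicit Defensive.

Local Open Scope ring_scope.
Local Open Scope classical_set_scope.

(* The standard (norm) topology on C = R[i]. *)
HB.instance Definition _ (R : rcfType) := PseudoPointedMetric.copy R[i] (R[i])^o.

Section Defs.
Variable R : realType.
Local Notation C := R[i].

(* J is the antidiagonal matrix, so that
   hform Z W = z1 conj(w3) + z2 conj(w2) + z3 conj(w1). *)
Definition Jmx : 'M[C]_3 := \matrix_(i, j) (if (i + j == 2)%N then 1 else 0).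

Definition hadj m n (A : 'M[C]_(m, n)) : 'M[C]_(n, m) := (map_mx conjc A)^T.

Definition hform (Z W : 'cV[C]_3) : C := (hadj W *m Jmx *m Z) ord0 ord0.

Definition U21 (A : 'M[C]_3) : Prop := A \in unitmx /\ hadj A *m Jmx *m A = Jmx.

(* nonzero null vectors (subspace topology from C^3) *)
Definition null_vec : set 'cV[C]_3 := [set Z | Z != 0 /\ hform Z Z = 0].

Definition proportional (u v : null_vec) : bool :=
  `[< exists l : C, l != 0 /\ val v = l *: val u >].

Lemma proportional_refl : reflexive proportional.
Proof.
by move=> u; apply/asboolP; exists 1; rewrite oner_neq0 scale1r.
Qed.

Lemma proportional_sym : symmetric proportional.
Proof.
suff H : forall u v, proportional u v -> proportional v u.
  by move=> u v; apply/idP/idP; apply: H.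
move=> u v /asboolP [l [l0 e]]; apply/asboolP; exists l^-1.
by rewrite invr_eq0 l0 e scalerA mulVf // scale1r.
Qed.

Lemma proportional_trans : transitive proportional.
Proof.
move=> v u w /asboolP [l [l0 e1]] /asboolP [k [k0 e2]]; apply/asboolP.
by exists (k * l); rewrite mulf_neq0 // e2 e1 scalerA.
Qed.

Canonical proportional_equiv : equiv_rel null_vec :=
  EquivRel proportional proportional_refl proportional_sym proportional_trans.

(* boundary points = null lines = nonzero null vectors modulo C^*, quotient topology *)
Definition Bdry := quotient_topology {eq_quot proportional}%qT.

Definition lift (p : Bdry) : 'cV[C]_3 := val (repr p).

Definition Quad := (Bdry * Bdry * Bdry * Bdry)%type.
Definition q1 (x : Quad) := x.1.1.1.
Definition q2 (x : Quad) := x.1.1.2.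
Definition q3 (x : Quad) := x.1.2.
Definition q4 (x : Quad) := x.2.

Definition distinct4 : set Quad := [set x |
  q1 x <> q2 x /\ q1 x <> q3 x /\ q1 x <> q4 x /\
  q2 x <> q3 x /\ q2 x <> q4 x /\ q3 x <> q4 x].

(* ordered quadruples of distinct boundary points (subspace topology) *)
Definition Conf := set_type distinct4.

(* A in U(2,1) (a lift of an element of PU(2,1)) maps the null line p to q *)
Definition maps_to (A : 'M[C]_3) (p q : Bdry) : Prop :=
  exists l : C, l != 0 /\ lift q = l *: (A *m lift p).

Definition pu_rel (x y : Conf) : bool := `[< exists A, U21 A /\
  [/\ maps_to A (q1 (val x)) (q1 (val y)), maps_to A (q2 (val x)) (q2 (val y)),
      maps_to A (q3 (val x)) (q3 (val y)) & maps_to A (q4 (val x)) (q4 (val y))] >].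

Lemma hadj1 : hadj (1%:M : 'M[C]_3) = 1%:M.
Proof. by rewrite /hadj map_mx1 trmx1. Qed.

Lemma hadjM (A B : 'M[C]_3) : hadj (A *m B) = hadj B *m hadj A.
Proof. by rewrite /hadj map_mxM trmx_mul. Qed.

Lemma U21_1 : U21 1%:M.
Proof. by split; [exact: unitmx1 | rewrite hadj1 mul1mx mulmx1]. Qed.

Lemma U21_mul A B : U21 A -> U21 B -> U21 (A *m B).
Proof.
move=> [uA hA] [uB hB]; split; first by rewrite unitmx_mul uA uB.
by rewrite hadjM -!mulmxA (mulmxA (hadj A)) (mulmxA (hadj A *m Jmx)) hA
  mulmxA hB.
Qed.

Lemma U21_inv A : U21 A -> U21 (invmx A).
Proof.
move=> [uA hA]; split; first by rewrite unitmx_inv.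
rewrite -{1}hA !mulmxA -hadjM mulmxV // hadj1 mul1mx.
by rewrite -mulmxA mulmxV // mulmx1.
Qed.

Lemma maps_to1 p : maps_to 1%:M p p.
Proof. by exists 1; rewrite oner_neq0 mul1mx scale1r. Qed.

Lemma maps_to_inv A p q : U21 A -> maps_to A p q -> maps_to (invmx A) q p.
Proof.
move=> [uA _] [l [l0 e]]; exists l^-1; split; first by rewrite invr_eq0.
by rewrite e -scalemxAr mulmxA mulVmx // mul1mx scalerA mulVf // scale1r.
Qed.

Lemma maps_to_comp A B p q r :
  maps_to A p q -> maps_to B q r -> maps_to (B *m A) p r.
Proof.
move=> [l [l0 e1]] [k [k0 e2]]; exists (k * l); split; first by rewrite mulf_neq0.
by rewrite e2 e1 -scalemxAr scalerA mulmxA.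
Qed.

Lemma pu_rel_refl : reflexive pu_rel.
Proof. by move=> x; apply/asboolP; exists 1%:M; split; [exact: U21_1|split; exact: maps_to1]. Qed.

Lemma pu_rel_sym_imp x y : pu_rel x y -> pu_rel y x.
Proof.
move=> /asboolP [A [hA [m1 m2 m3 m4]]]; apply/asboolP; exists (invmx A).
by split; [exact: U21_inv | split; exact: maps_to_inv].
Qed.

Lemma pu_rel_sym : symmetric pu_rel.
Proof. by move=> x y; apply/idP/idP; apply: pu_rel_sym_imp. Qed.

Lemma pu_rel_trans : transitive pu_rel.
Proof.
move=> y x z /asboolP [A [hA [a1 a2 a3 a4]]] /asboolP [B [hB [b1 b2 b3 b4]]].
apply/asboolP; exists (B *m A); split; first exact: U21_mul.
split; [exact: maps_to_comp a1 b1 | exact: maps_to_comp a2 b2 |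
        exact: maps_to_comp a3 b3 | exact: maps_to_comp a4 b4].
Qed.

Canonical pu_equiv : equiv_rel Conf :=
  EquivRel pu_rel pu_rel_refl pu_rel_sym pu_rel_trans.

Definition Config := quotient_topology {eq_quot pu_rel}%qT.

Definition cross (P1 P2 P3 P4 : 'cV[C]_3) : C :=
  (hform P3 P1 * hform P4 P2) / (hform P4 P1 * hform P3 P2).

(* principal argument in (-pi, pi] (value at 0 is irrelevant) *)
Definition carg (z : C) : R :=
  let r := Num.sqrt (complex.Re z ^+ 2 + complex.Im z ^+ 2) in
  if 0 <= complex.Im z then acos (complex.Re z / r) else - acos (complex.Re z / r).

Definition cartan (P1 P2 P3 : 'cV[C]_3) : R :=
  carg (- (hform P1 P2 * hform P2 P3 * hform P3 P1)).

Definition tau (c : Config) : (C * C * R)%type :=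
  let x := val (repr c) in
  let P1 := lift (q1 x) in let P2 := lift (q2 x) in
  let P3 := lift (q3 x) in let P4 := lift (q4 x) in
  (cross P1 P2 P3 P4, cross P1 P3 P2 P4, cartan P1 P2 P3).

Definition expi (t : R) : C := (cos t +i* sin t)%C.
Definition sqnorm (z : C) : R := complex.Re z ^+ 2 + complex.Im z ^+ 2.

Definition Mset : set (C * C * R)%type := [set t |
  let X1 := t.1.1 in let X2 := t.1.2 in let A := t.2 in
  [/\ X1 != 0, X2 != 0,
      - 2 * complex.Re (X1 + X2) - 2 * complex.Re (X1 * conjc X2 * expi (- (2 * A)))
        + sqnorm X1 + sqnorm X2 + 1 = 0,
      - (trigo.pi / 2) <= A <= trigo.pi / 2
    & 0 <= complex.Re (X1 * expi (- A))]].

End Defs.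

(* Main.v *)
(* A quadruple of distinct null lines is moved by U(2,1) to the standard lifts
   (1,0,0), (0,0,1), (z3,w3,1), (z4,w4,1) with |z3| = 1. For these, e^{iA} = - conj z3,
   X1 = z4 / z3 and conj z3 (X2 - 1) - z4 = w4 conj w3, so (X1, X2, A) determines z3, z4 and the
   Gram matrix of (w3, w4) in C, that is, (w3, w4) up to a common phase, which is the action of
   diag(1,u,1). This gives injectivity, and the equation of M is exactly the condition
   |w4 conj w3|^2 = |w3|^2 |w4|^2 for such (w3, w4) to exist, where |w3|^2 = 2 cos A and
   |w4|^2 = 2 Re (X1 e^{-iA}) must be nonnegative. The inverse is continuous because near each
   point of M one of two choices of phase, w3 >= 0 or w4 >= 0, is continuous: the choice w4 >= 0
   where w4 <> 0, and the choice w3 >= 0 where w4 = 0, since there w4 tends to 0 in any phase. *)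

Require Import Defs.
From HB Require Import structures.
From mathcomp Require Import all_boot all_order all_algebra.
From mathcomp Require Import all_classical all_reals all_analysis.
From mathcomp Require Import complex generic_quotient finmap.
From mathcomp Require Import ring lra.
Import Order.TTheory GRing.Theory Num.Theory.
Import numFieldTopology.Exports numFieldNormedType.Exports.
Set Implicit Arguments.
Unset Strict Implicit.
Unset Printing Implicit Defensive.
Local Open Scope ring_scope.
Local Open Scope classical_set_scope.

(** * Continuity of complex-valued functions *)

Section ComplexContinuity.
Variable R : realType.
Local Notation C := R[i].

(** The norm of [R[i]] takes values in [R[i]], where a positive element is necessarily real, so a
    real [e] suffices. *)
Lemma cvgC_dist (T : Type) (F : set_system T) {FF : Filter F} (f : T -> C) (a : C) :
  f @ F --> a <-> forall e : R, 0 < e -> \forall x \near F, `|a - f x| < e%:C%C.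
Proof.
split=> [h e e0|h].
  by move/(@cvgr_dist_lt R[i] (R[i])^o _ F FF): h; apply; rewrite ltcR.
apply/(@cvgrPdist_lt R[i] (R[i])^o _ F FF) => e e0.
have e1 : (complex.Re e)%:C%C = e by rewrite RRe_real // gtr0_real.
by rewrite -e1; apply: h; rewrite -ltcR e1.
Qed.

Section At.
Variables (T : topologicalType) (x : T).
Implicit Types (f g : T -> C) (u v : T -> R).

Lemma near_eq_continuous (U : topologicalType) (f g : T -> U) :
  {near x, f =1 g} -> {for x, continuous g} -> {for x, continuous f}.
Proof.
move=> fg cg; rewrite /prop_for /continuous_at (nbhs_singleton fg).
by apply: cvg_trans cg; apply: near_eq_cvg; apply: filterS fg => t ->.
Qed.

Lemma eq_continuous_at (U : topologicalType) (g f : T -> U) :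
  f =1 g -> {for x, continuous g} -> {for x, continuous f}.
Proof. by move=> fg; apply: near_eq_continuous; apply: nearW => t; exact: fg. Qed.

Lemma continuous_pair_at (U V : topologicalType) (f : T -> U) (g : T -> V) :
  {for x, continuous f} -> {for x, continuous g} ->
  {for x, continuous (fun t => (f t, g t))}.
Proof. by move=> cf cg; exact: cvg_pair. Qed.

(** Subspaces carry the initial topology of [val], so continuity into [null_vec] or [Conf] reduces
    to continuity of the underlying vector or quadruple. *)
Lemma continuous_initial_at (Y : choiceType) (Z : topologicalType) (w : Y -> Z)
  (f : T -> initial_topology w) : {for x, continuous (w \o f)} -> {for x, continuous f}.
Proof.
move=> cf U [?/= [[W oW <-]]] /= Wsfz /filterS; apply; apply: cf.
exact: open_nbhs_nbhs.
Qed.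

Lemma contC_cst (c : C) : {for x, continuous (fun _ : T => c)}.
Proof. exact: cvg_cst. Qed.

Lemma contC_add f g : {for x, continuous f} -> {for x, continuous g} ->
  {for x, continuous (fun t => f t + g t)}.
Proof. exact: (@cvgD R[i] (R[i])^o _ (nbhs x) _ f g (f x) (g x)). Qed.

Lemma contC_opp f : {for x, continuous f} -> {for x, continuous (fun t => - f t)}.
Proof. exact: (@cvgN R[i] (R[i])^o _ (nbhs x) _ f (f x)). Qed.

Lemma contC_mul f g : {for x, continuous f} -> {for x, continuous g} ->
  {for x, continuous (fun t => f t * g t)}.
Proof. exact: (@cvgM R[i] _ (nbhs x) _ f g (f x) (g x)). Qed.

Lemma contC_inv f : f x != 0 -> {for x, continuous f} -> {for x, continuous (fun t => (f t)^-1)}.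
Proof. exact: (@cvgV R[i] _ (nbhs x) _ f (f x)). Qed.

Lemma contC_div f g : {for x, continuous f} -> {for x, continuous g} -> g x != 0 ->
  {for x, continuous (fun t => f t / g t)}.
Proof. by move=> cf cg g0; exact: (@contC_mul f (fun t => (g t)^-1) cf (contC_inv g0 cg)). Qed.

Lemma contC_conj f : {for x, continuous f} -> {for x, continuous (fun t => conjc (f t))}.
Proof.
move/cvgC_dist => h; apply/cvgC_dist => e e0; near=> t.
by rewrite -rmorphB normcJ; near: t; exact: h.
Unshelve. all: by end_near. Qed.

Lemma contC_Re f : {for x, continuous f} -> {for x, continuous (fun t => complex.Re (f t))}.
Proof.
move/cvgC_dist => h; apply/cvgrPdist_lt => e e0; near=> t.
have le : (`|complex.Re (f x) - complex.Re (f t)|%:C <= `|f x - f t|)%C.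
  by have := normc_ge_Re (f x - f t); rewrite (raddfB (@complex.Re R)).
rewrite -ltcR; apply: (le_lt_trans le); near: t; exact: h.
Unshelve. all: by end_near. Qed.

Lemma contC_cplx u v : {for x, continuous u} -> {for x, continuous v} ->
  {for x, continuous (fun t => (u t +i* v t)%C)}.
Proof.
move=> /cvgrPdist_lt hu /cvgrPdist_lt hv; apply/cvgC_dist => e e0; near=> t.
have -> : (u x +i* v x - (u t +i* v t) = (u x - u t)%:C + 'i%C * (v x - v t)%:C)%C by simpc.
apply: le_lt_trans (ler_normD _ _) _.
rewrite normrM !normc_def /= !expr0n /= expr1n add0r addr0 sqrtr1 mul1r !addr0 !sqrtr_sqr.
rewrite -(rmorphD (real_complex R)) /= ltcR (splitr e) ltrD //; near: t.
  by apply: hu; rewrite divr_gt0.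
by apply: hv; rewrite divr_gt0.
Unshelve. all: by end_near. Qed.

(** A neighbourhood of a matrix contains a product of neighbourhoods of its entries, and a finite
    intersection of neighbourhoods is one. *)
Lemma continuous_mx_at m n (f : T -> 'M[C]_(m, n)) :
  (forall i j, {for x, continuous (fun t => f t i j)}) -> {for x, continuous f}.
Proof.
move=> h A [P hP sPA]; rewrite /= nbhs_filterE.
pose Q (k : 'I_m * 'I_n) := [set t | P k.1 k.2 (f t k.1 k.2)].
apply: (filterS (P := \bigcap_(k in [set: 'I_m * 'I_n]) Q k)).
  by move=> t ht; apply: sPA => i j; exact: (ht (i, j)).
rewrite (_ : \bigcap_(k in _) _ =
             \bigcap_(k in [set k | k \in [fset k in predT]%fset]) Q k).
  by apply: filter_bigI => k _; exact: (h k.1 k.2 _ (hP k.1 k.2)).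
by rewrite predeqE => t; split => ht k _; apply: ht => //=; rewrite !inE.
Qed.

End At.

Lemma continuous_Re : continuous (@complex.Re R).
Proof. by move=> z; exact: (@contC_Re C z id (@cvg_id _ (nbhs z))). Qed.

Lemma continuous_Im : continuous (@complex.Im R).
Proof.
move=> z; have cid : {for z, continuous (@id C)} by exact: cvg_id.
(* Im z is the real part of - (z i). *)
apply: eq_continuous_at (contC_Re (contC_opp (contC_mul cid (@contC_cst _ z 'i%C)))).
by case=> a b; rewrite /=; ring.
Qed.

End ComplexContinuity.

(** * The Hermitian form and U(2,1) *)

Section HermitianForm.
Variable R : realType.
Local Notation C := R[i].
Implicit Types (Z W : 'cV[C]_3) (l : C).
Local Notation o0 := (@Ordinal 3 0 isT).
Local Notation o1 := (@Ordinal 3 1 isT).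
Local Notation o2 := (@Ordinal 3 2 isT).

Definition vec3 (a b c : C) : 'cV[C]_3 := \col_i nth 0 [:: a; b; c] i.

Lemma ord3P (P : 'I_3 -> Prop) : P o0 -> P o1 -> P o2 -> forall i, P i.
Proof.
by move=> p0 p1 p2 [[|[|[|i]]] hi] //; [move: p0|move: p1|move: p2]; congr P; apply: val_inj.
Qed.

Lemma vec3_eta Z : Z = vec3 (Z o0 ord0) (Z o1 ord0) (Z o2 ord0).
Proof. by apply/colP; apply: ord3P; rewrite mxE. Qed.

Lemma vec3P Z : exists a b c, Z = vec3 a b c.
Proof. by do 3 eexists; exact: vec3_eta. Qed.

Lemma vec3_inj a b c a' b' c' :
  vec3 a b c = vec3 a' b' c' -> [/\ a = a', b = b' & c = c'].
Proof.
move=> /colP h; split; [have := h o0|have := h o1|have := h o2]; by rewrite !mxE.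
Qed.

Lemma scale_vec3 l a b c : l *: vec3 a b c = vec3 (l * a) (l * b) (l * c).
Proof. by apply/colP; apply: ord3P; rewrite !mxE. Qed.

Lemma add_vec3 a b c a' b' c' : vec3 a b c + vec3 a' b' c' = vec3 (a + a') (b + b') (c + c').
Proof. by apply/colP; apply: ord3P; rewrite !mxE. Qed.

Lemma vec3_eq0 a b c : (vec3 a b c == 0) = [&& a == 0, b == 0 & c == 0].
Proof.
apply/eqP/and3P => [|[/eqP-> /eqP-> /eqP->]].
  rewrite [RHS](_ : _ = vec3 0 0 0) => [/vec3_inj[-> -> ->]//|].
  by apply/colP; apply: ord3P; rewrite !mxE.
by apply/colP; apply: ord3P; rewrite !mxE.
Qed.

Lemma sum3 (V : nmodType) (f : 'I_3 -> V) : \sum_i f i = f o0 + f o1 + f o2.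
Proof.
rewrite !big_ord_recl big_ord0 addr0 addrA.
by congr (f _ + f _ + f _); apply: val_inj.
Qed.

Lemma hform_vec3 a b c x y z :
  hform (vec3 a b c) (vec3 x y z) = a * conjc z + b * conjc y + c * conjc x.
Proof. by rewrite /hform !mxE sum3 !mxE !sum3 !mxE /=; ring. Qed.

Lemma hformZl l Z W : hform (l *: Z) W = l * hform Z W.
Proof.
have [a [b [c ->]]] := vec3P Z; have [x [y [z ->]]] := vec3P W.
by rewrite scale_vec3 !hform_vec3; ring.
Qed.

Lemma hformC Z W : conjc (hform Z W) = hform W Z.
Proof.
have [a [b [c ->]]] := vec3P Z; have [x [y [z ->]]] := vec3P W.
by rewrite !hform_vec3 !rmorphD !rmorphM /= !conjcK; ring.
Qed.

Lemma hformZr l Z W : hform Z (l *: W) = conjc l * hform Z W.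
Proof. by rewrite -hformC hformZl rmorphM /= hformC. Qed.

Lemma hformDl Z Z' W : hform (Z + Z') W = hform Z W + hform Z' W.
Proof.
have [a [b [c ->]]] := vec3P Z; have [x [y [z ->]]] := vec3P W.
have [a' [b' [c' ->]]] := vec3P Z'.
by rewrite add_vec3 !hform_vec3; ring.
Qed.

Lemma hformDr Z W W' : hform Z (W + W') = hform Z W + hform Z W'.
Proof. by rewrite -hformC hformDl rmorphD /= !hformC. Qed.

Lemma hadj_mulmx m n p (A : 'M[C]_(m, n)) (B : 'M[C]_(n, p)) :
  hadj (A *m B) = hadj B *m hadj A.
Proof. by rewrite /hadj map_mxM trmx_mul. Qed.

Lemma hform_U21 A Z W : U21 A -> hform (A *m Z) (A *m W) = hform Z W.
Proof.
move=> [_ hA]; rewrite /hform hadj_mulmx -!mulmxA (mulmxA (Jmx _)).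
by rewrite (mulmxA (hadj A)) (mulmxA (hadj A)) hA.
Qed.

Definition mx3 (u v w : 'cV[C]_3) : 'M[C]_3 := \matrix_(i, j) nth 0 [:: u; v; w] j i ord0.

Lemma mul_mx3 u v w a b c : mx3 u v w *m vec3 a b c = a *: u + b *: v + c *: w.
Proof. by apply/colP => i; rewrite !mxE sum3 !mxE /=; ring. Qed.

Lemma Jmx_sqr : Jmx R *m Jmx R = 1%:M.
Proof.
apply/matrixP; apply: ord3P; apply: ord3P; rewrite !mxE sum3 !mxE /=; ring.
Qed.

(** The entries of [hadj A *m J *m A] are the products of the columns of [A], and the hypotheses say
    that this Gram matrix is J. Substituting it for one factor in J J = 1 exhibits a left inverse of
    [A]. *)
Lemma U21_mx3 u v w : hform u u = 0 -> hform w w = 0 -> hform v v = 1 ->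
  hform u w = 1 -> hform u v = 0 -> hform w v = 0 -> U21 (mx3 u v w).
Proof.
move=> uu ww vv uw uv wv.
have wu : hform w u = 1 by rewrite -hformC uw rmorph1.
have vu : hform v u = 0 by rewrite -hformC uv rmorph0.
have vw : hform v w = 0 by rewrite -hformC wv rmorph0.
have E : hadj (mx3 u v w) *m Jmx R *m mx3 u v w = Jmx R.
  have gE i j : (hadj (mx3 u v w) *m Jmx R *m mx3 u v w) i j =
      hform (nth 0 [:: u; v; w] j) (nth 0 [:: u; v; w] i).
    rewrite /hform !mxE; apply: eq_bigr => k _; rewrite !mxE; congr (_ * _).
    by apply: eq_bigr => n _; rewrite !mxE.
  by apply/matrixP; apply: ord3P; apply: ord3P; rewrite gE !mxE /=.
split=> //.
by have := Jmx_sqr; rewrite -{2}E !mulmxA => /mulmx1_unit [_].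
Qed.

Lemma conjM_eq0 (z : C) : z * conjc z = 0 -> z = 0.
Proof. by move/eqP; rewrite mulf_eq0 conjc_eq0 orbb => /eqP. Qed.

(** In signature (2,1) a totally isotropic subspace is at most a line. Hence lifts of distinct
    boundary points never have product zero. *)
Lemma null_orthogonal Z W : null_vec Z -> null_vec W -> hform Z W = 0 ->
  exists2 l : C, l != 0 & W = l *: Z.
Proof.
move=> [Z0 Zn] [W0 Wn] ZW.
suff [l Wl] : exists l : C, W = l *: Z.
  by exists l => //; apply: contra_neq W0 => l0; rewrite Wl l0 scale0r.
have WZ : hform W Z = 0 by rewrite -hformC ZW rmorph0.
have [a [b [c eZ]]] := vec3P Z.
(* A null vector with last coordinate 0 also has middle coordinate 0, so here [Z] spans the line of
   (1,0,0). Orthogonality to it makes the last coordinate of [W] vanish, and the same argument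
   applies to [W]. *)
have [c0|c0] := eqVneq c 0.
  have [x [y [z eW]]] := vec3P W.
  move: Z0 Zn ZW Wn; rewrite eZ eW c0 !hform_vec3 vec3_eq0 rmorph0 eqxx andbT.
  rewrite mulr0 mul0r !addr0 add0r => ab /conjM_eq0 b0; move: ab.
  rewrite b0 eqxx andbT mul0r addr0 => a0 /eqP.
  rewrite mul0r addr0 mulf_eq0 (negbTE a0) conjc_eq0 /= => /eqP ->.
  rewrite rmorph0 mulr0 add0r mul0r addr0 => /conjM_eq0 ->.
  by exists (x / a); rewrite scale_vec3 divfK // !mulr0.
have [x [y [z eW]]] := vec3P W.
(* [V] is null and orthogonal to [Z], and its last coordinate vanishes, so it is zero. *)
pose V := W + (- (z / c)) *: Z.
have VZ : hform V Z = 0 by rewrite hformDl hformZl WZ Zn mulr0 addr0.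
have VV : hform V V = 0.
  by rewrite hformDr hformZr VZ mulr0 addr0 hformDl hformZl Wn ZW mulr0 addr0.
have eV : V = vec3 (x - z / c * a) (y - z / c * b) 0.
  by rewrite /V eW eZ scale_vec3 add_vec3 !mulNr divfK // subrr.
move: VV VZ; rewrite eV eZ !hform_vec3 rmorph0 mulr0 mul0r add0r addr0.
move=> /conjM_eq0 v1; rewrite v1 !mul0r !addr0 => /eqP.
rewrite mulf_eq0 conjc_eq0 (negbTE c0) orbF => /eqP v0.
have /eqP : V = 0 by rewrite eV v0 v1; apply/eqP; rewrite vec3_eq0 eqxx.
by rewrite /V scaleNr subr_eq0 => /eqP h; exists (z / c); rewrite -eZ.
Qed.

Definition e1 := vec3 1 0 0.
Definition e3 := vec3 0 0 1.

(* The middle vector of the frame is the Hermitian cross product of [Z] and [W]. *)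
Lemma U21_frame Z W : hform Z Z = 0 -> hform W W = 0 -> hform Z W = 1 ->
  exists A, [/\ U21 A, A *m Z = e1 & A *m W = e3].
Proof.
have [a [b [c eZ]]] := vec3P Z; have [x [y [z eW]]] := vec3P W.
move=> ZZ WW ZW; have WZ : hform W Z = 1 by rewrite -hformC ZW rmorph1.
pose V := vec3 (conjc (a * y - b * x)) (conjc (c * x - a * z)) (conjc (b * z - c * y)).
have ZV : hform Z V = 0 by rewrite eZ hform_vec3 !conjcK; ring.
have WV : hform W V = 0 by rewrite eW hform_vec3 !conjcK; ring.
have VV : hform V V = 1.
  (* Lagrange's identity for the Hermitian cross product. *)
  transitivity (hform Z W * hform W Z - hform Z Z * hform W W).
    rewrite eZ eW !hform_vec3 !conjcK !(rmorphB, rmorphM) /=; ring.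
  by rewrite ZW WZ ZZ mul0r subr0 mulr1.
have hA := U21_mx3 ZZ WW VV ZW ZV WV.
have [uA _] := hA.
exists (invmx (mx3 Z V W)); split; first exact: U21_inv.
  have {2}-> : Z = mx3 Z V W *m e1 by rewrite mul_mx3 scale1r !scale0r !addr0.
  by rewrite mulmxA mulVmx // mul1mx.
have {2}-> : W = mx3 Z V W *m e3 by rewrite mul_mx3 scale1r !scale0r !add0r.
by rewrite mulmxA mulVmx // mul1mx.
Qed.

Definition diag3 (a b c : C) := mx3 (vec3 a 0 0) (vec3 0 b 0) (vec3 0 0 c).

Lemma mul_diag3 a b c x y z : diag3 a b c *m vec3 x y z = vec3 (a * x) (b * y) (c * z).
Proof.
rewrite mul_mx3 !scale_vec3 !add_vec3 !mulr0 !addr0 !add0r.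
by rewrite (mulrC x) (mulrC y) (mulrC z).
Qed.

Lemma U21_diag3 a b c : a * conjc c = 1 -> b * conjc b = 1 -> U21 (diag3 a b c).
Proof.
by move=> ac bb; apply: U21_mx3; rewrite hform_vec3 !rmorph0 ?ac ?bb; ring.
Qed.

Lemma mulcJ_sqnorm (z : C) : z * conjc z = (sqnorm z)%:C%C.
Proof. by rewrite -sqr_normc -add_Re2_Im2. Qed.

Lemma sqnorm_gt0 (z : C) : (0 < sqnorm z) = (z != 0).
Proof.
rewrite lt_def addr_ge0 ?sqr_ge0 // andbT -(inj_eq (@complexI R)) -mulcJ_sqnorm.
by rewrite rmorph0 mulf_eq0 conjc_eq0 orbb.
Qed.

(** A frame sends the first two lines to those of [e1] and [e3]. The other two vectors have nonzero
    last coordinate, which is scaled to 1. Finally diag(r,1,1/r) preserves the lines of [e1] and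
    [e3] and multiplies the first coordinates of the other two by r^2 once their last coordinates
    are scaled back to 1, which allows |z3| = 1. *)
Lemma normal_form (P : 'I_4 -> 'cV[C]_3) :
  (forall i, null_vec (P i)) -> (forall i j, i != j -> hform (P i) (P j) != 0) ->
  exists A (z3 w3 z4 w4 : C), [/\ U21 A, z3 * conjc z3 = 1 &
    forall i : 'I_4, exists2 l : C, l != 0 &
      nth 0 [:: e1; e3; vec3 z3 w3 1; vec3 z4 w4 1] i = l *: (A *m P i)].
Proof.
move=> nP gP.
pose i0 := @Ordinal 4 0 isT; pose i1 := @Ordinal 4 1 isT.
pose i2 := @Ordinal 4 2 isT; pose i3 := @Ordinal 4 3 isT.
have g01 : hform (P i0) (P i1) != 0 by exact: gP.
(* The form is conjugate-linear in its second argument, so this [k] makes the product of [P i0] with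
   [k *: P i1] equal to 1. *)
pose k := (conjc (hform (P i0) (P i1)))^-1.
have k0 : k != 0 by rewrite invr_eq0 conjc_eq0.
have [||| A [hA A0 A1]] := @U21_frame (P i0) (k *: P i1).
- by case: (nP i0).
- by rewrite hformZl hformZr; case: (nP i1) => _ ->; rewrite !mulr0.
- by rewrite hformZr /k conjc_inv conjcK mulVf.
have [a [b [c e2]]] := vec3P (A *m P i2).
have [x [y [z e3']]] := vec3P (A *m P i3).
(* The product with [e1] reads off the last coordinate, and the product with [e3] the first one. *)
have c0 : c != 0.
  have := gP i2 i0 isT; rewrite -(hform_U21 _ _ hA) A0 e2 hform_vec3.
  by rewrite rmorph0 rmorph1 !mulr0 !add0r mulr1.
have z0 : z != 0.
  have := gP i3 i0 isT; rewrite -(hform_U21 _ _ hA) A0 e3' hform_vec3.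
  by rewrite rmorph0 rmorph1 !mulr0 !add0r mulr1.
have a0 : a != 0.
  have : hform (P i2) (k *: P i1) != 0 by rewrite hformZr mulf_neq0 ?conjc_eq0 ?gP.
  rewrite -(hform_U21 _ _ hA) A1 e2 hform_vec3.
  by rewrite rmorph0 rmorph1 !mulr0 !addr0 mulr1.
(* [n] is the modulus of a / c, and [r] is chosen with r^2 n = 1. *)
pose n : R := Num.sqrt (sqnorm (a / c)).
have n0 : 0 < n by rewrite sqrtr_gt0 sqnorm_gt0 mulf_neq0 ?invr_eq0.
pose r := Num.sqrt n^-1.
have r0 : r != 0 by rewrite gt_eqF // sqrtr_gt0 invr_gt0.
have rr : r ^+ 2 * n = 1 by rewrite sqr_sqrtr ?invr_ge0 ?ltW // mulVf // gt_eqF.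
pose D := diag3 r%:C%C 1 (r^-1)%:C%C.
have hD : U21 D.
  apply: U21_diag3; last by rewrite rmorph1 mulr1.
  by rewrite conjc_real -rmorphM mulfV.
have rC0 : (r%:C)%C != 0 :> C by rewrite -(rmorph0 (real_complex R)) (inj_eq (@complexI R)).
have rV : (r^-1)%:C%C = (r%:C%C)^-1 :> C by rewrite fmorphV.
have scl (u v w : C) : w != 0 -> vec3 (r%:C%C ^+ 2 * (u / w)) (r%:C%C * (v / w)) 1 =
    (r%:C%C / w) *: (D *m vec3 u v w).
  move=> w0; rewrite mul_diag3 scale_vec3 rV.
  move: (r%:C%C) rC0 => s s0.
  by congr vec3; field; rewrite ?w0 ?s0.
exists (D *m A), (r%:C%C ^+ 2 * (a / c)), (r%:C%C * (b / c)).
exists (r%:C%C ^+ 2 * (x / z)), (r%:C%C * (y / z)).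
split; first exact: U21_mul.
  have nn : a / c * conjc (a / c) = (n ^+ 2)%:C%C.
    by rewrite mulcJ_sqnorm sqr_sqrtr // ltW // sqnorm_gt0 mulf_neq0 ?invr_eq0.
  have cr : conjc (r%:C%C ^+ 2) = r%:C%C ^+ 2 :> C.
    by rewrite rmorphXn; congr (_ ^+ _); exact: conjc_real.
  have -> : conjc (r%:C%C ^+ 2 * (a / c)) = r%:C%C ^+ 2 * conjc (a / c).
    by rewrite -[in RHS]cr; exact: rmorphM.
  have <- : (r ^+ 2 * r ^+ 2 * n ^+ 2)%:C%C = 1 :> C.
    by rewrite -expr2 -exprMn rr expr1n rmorph1.
  rewrite mulrACA nn !expr2.
  by rewrite !(rmorphM (real_complex R)).
have De1 : D *m e1 = r%:C%C *: e1 by rewrite mul_diag3 scale_vec3 !mulr0 mulr1.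
have De3 : D *m e3 = (r%:C%C)^-1 *: e3 by rewrite mul_diag3 scale_vec3 rV !mulr0 mulr1.
case=> [[|[|[|[|//]]]] hi]; rewrite -mulmxA.
- rewrite (_ : Ordinal _ = i0); last exact: val_inj.
  by exists (r%:C%C)^-1; rewrite ?invr_eq0 //= A0 De1 scalerA mulVf // scale1r.
- rewrite (_ : Ordinal _ = i1); last exact: val_inj.
  exists (r%:C%C * k); rewrite ?mulf_neq0 //= -scalerA [k *: (D *m _)]scalemxAr.
  by rewrite [k *: (A *m _)]scalemxAr A1 De3 scalerA mulfV // scale1r.
- rewrite (_ : Ordinal _ = i2); last exact: val_inj.
  by exists (r%:C%C / c); rewrite ?mulf_neq0 ?invr_eq0 //= e2 scl.
- rewrite (_ : Ordinal _ = i3); last exact: val_inj.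
  by exists (r%:C%C / z); rewrite ?mulf_neq0 ?invr_eq0 //= e3' scl.
Qed.

End HermitianForm.

(** * The principal argument and the equation of M *)

Section Argument.
Variable R : realType.
Local Notation C := R[i].
Local Notation ipi := (trigo.pi (R := R)).
Implicit Types (A : R) (z w : C).

Lemma sqnorm_ge0 z : 0 <= sqnorm z.
Proof. by rewrite addr_ge0 ?sqr_ge0. Qed.

Lemma sqnormM z w : sqnorm (z * w) = sqnorm z * sqnorm w.
Proof. by case: z w => a b [c d]; rewrite /sqnorm /=; ring. Qed.

Lemma sqnormJ z : sqnorm (conjc z) = sqnorm z.
Proof. by case: z => a b; rewrite /sqnorm /=; ring. Qed.

Lemma sqnormN z : sqnorm (- z) = sqnorm z.
Proof. by case: z => a b; rewrite /sqnorm /=; ring. Qed.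

Lemma sqnorm_expi A : sqnorm (expi A) = 1.
Proof. by rewrite /sqnorm /= cos2Dsin2. Qed.

Lemma expiN A : expi (- A) = conjc (expi A).
Proof. by rewrite /expi cosN sinN. Qed.

Lemma expiD A B : expi (A + B) = expi A * expi B.
Proof.
rewrite /expi cosD sinD; apply/eqP; rewrite eq_complex /=.
by apply/andP; split; apply/eqP; ring.
Qed.

Lemma cos_half_pi_ge0 A : - (ipi / 2) <= A <= ipi / 2 -> 0 <= cos A.
Proof. by move=> h; exact: cos_ge0_pihalf. Qed.

Lemma carg_expi A : - (ipi / 2) <= A <= ipi / 2 -> carg (expi A) = A.
Proof.
move=> /andP[A1 A2]; have p0 := pi_gt0 R.
rewrite /carg /= cos2Dsin2 sqrtr1 divr1.
have [A0|A0] := leP 0 A.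
  rewrite sin_ge0_pi ?cosK // ?in_itv /= ?A0 //=; lra.
rewrite ifF; first by rewrite cosKN ?opprK //; apply/andP; split; lra.
apply/negbTE; rewrite -ltNge -oppr_gt0 -sinN sin_gt0_pi //; apply/andP; split; lra.
Qed.

Lemma unit_circle_itv (x y : R) : x ^+ 2 + y ^+ 2 = 1 -> -1 <= x <= 1.
Proof. by move=> h; apply/andP; split; nra. Qed.

Lemma expi_carg z : sqnorm z = 1 -> expi (carg z) = z.
Proof.
case: z => x y; rewrite /sqnorm /carg /= => h; rewrite h sqrtr1 divr1.
have x1 := unit_circle_itv h.
have y2 : 1 - x ^+ 2 = y ^+ 2 by lra.
case: ifP => y0; rewrite /expi ?cosN ?sinN acosK ?in_itv //= sin_acos // y2 sqrtr_sqr.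
  by rewrite ger0_norm.
by rewrite ltr0_norm ?opprK // ltNge y0.
Qed.

(** Since cos decreases strictly on [0, pi], acos x > pi/2 would make x = cos (acos x) negative. *)
Lemma carg_bound z : sqnorm z = 1 -> 0 <= complex.Re z -> - (ipi / 2) <= carg z <= ipi / 2.
Proof.
case: z => x y; rewrite /sqnorm /carg /= => h x0; rewrite h sqrtr1 divr1.
have x1 := unit_circle_itv h; have a0 := acos_ge0 x1; have p0 := pi_gt0 R.
suff : acos x <= ipi / 2 by case: ifP => _ a1; apply/andP; split; lra.
rewrite leNgt; apply/negP => a1; have a2 := acos_lepi x1.
have : cos (acos x) < cos (ipi / 2) by rewrite ltr_cos // in_itv /=; apply/andP; split; lra.
by rewrite cos_pihalf acosK ?in_itv // ltNge x0.
Qed.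

Lemma carg_scale (k : R) z : 0 < k -> carg (k%:C%C * z) = carg z.
Proof.
case: z => x y k0; rewrite /carg /= !mul0r subr0 addr0.
have -> : (k * x) ^+ 2 + (k * y) ^+ 2 = k ^+ 2 * (x ^+ 2 + y ^+ 2) by ring.
rewrite sqrtrM ?sqr_ge0 // sqrtr_sqr gtr0_norm // pmulr_rge0 // -mulf_div divff ?gt_eqF //.
by rewrite mul1r.
Qed.

(* The value of [w4 * conjc w3] at the standard lifts with invariants [t = (X1, X2, A)]. *)
Definition gram43 (t : C * C * R) : C := - expi t.2 * (t.1.2 - 1) + t.1.1 * expi (- t.2).

(** The right-hand side is |w4 conj w3|^2 - |w3|^2 |w4|^2 in terms of the values that the invariants
    force at standard lifts. The two sides agree modulo cos^2 + sin^2 = 1. *)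
Lemma Mset_eqn (X1 X2 : C) A :
  - 2 * complex.Re (X1 + X2) - 2 * complex.Re (X1 * conjc X2 * expi (- (2 * A)))
        + sqnorm X1 + sqnorm X2 + 1 =
  sqnorm (gram43 (X1, X2, A)) - (2 * cos A) * (2 * complex.Re (X1 * expi (- A))).
Proof.
have -> : expi (- (2 * A)) = expi (- A) * expi (- A) by rewrite -expiD; congr expi; ring.
(* The relation is put in the form cos^2 = 1 - sin^2, which [ring] can use to eliminate the square
   of the cosine. *)
have /(congr1 (fun x => x - sin A ^+ 2)) := cos2Dsin2 A; rewrite addrK.
rewrite /gram43 /= !expiN /expi; move: (cos A) (sin A) => c s h.
case: X1 X2 => x y [u v]; rewrite /sqnorm /=.
ring: h.
Qed.

End Argument.

(** * Standard lifts *)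

Section StandardForm.
Variable R : realType.
Local Notation C := R[i].
Implicit Types (z w l : C) (P : 'cV[C]_3).
Local Notation e1 := (e1 R).
Local Notation e3 := (e3 R).

Definition invariants P1 P2 P3 P4 : C * C * R :=
  (cross P1 P2 P3 P4, cross P1 P3 P2 P4, cartan P1 P2 P3).

Lemma invariants_U21 (A : 'M[C]_3) P1 P2 P3 P4 : U21 A ->
  invariants (A *m P1) (A *m P2) (A *m P3) (A *m P4) = invariants P1 P2 P3 P4.
Proof. by move=> hA; rewrite /invariants /cross /cartan !(hform_U21 _ _ hA). Qed.

(** Numerator and denominator acquire the same factor [k]. *)
Lemma cross_scale l1 l2 l3 l4 P1 P2 P3 P4 : l1 != 0 -> l2 != 0 -> l3 != 0 -> l4 != 0 ->
  cross (l1 *: P1) (l2 *: P2) (l3 *: P3) (l4 *: P4) = cross P1 P2 P3 P4.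
Proof.
move=> h1 h2 h3 h4; rewrite /cross !(hformZl, hformZr).
set k := l3 * conjc l1 * (l4 * conjc l2).
have k0 : k != 0 by rewrite !mulf_neq0 ?conjc_eq0.
transitivity ((k * (hform P3 P1 * hform P4 P2)) / (k * (hform P4 P1 * hform P3 P2))).
  by rewrite /k; congr (_ / _); ring.
by rewrite -mulf_div divff // mul1r.
Qed.

Lemma realCM (x y : R) : (x * y)%:C%C = x%:C%C * y%:C%C :> C.
Proof. exact: (rmorphM (real_complex R)). Qed.

Lemma realCN (x : R) : (- x)%:C%C = - x%:C%C :> C.
Proof. exact: (rmorphN (real_complex R)). Qed.

Lemma conjCN z : conjc (- z) = - conjc z.
Proof. exact: (rmorphN conjc). Qed.

Lemma conjCM z w : conjc (z * w) = conjc z * conjc w.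
Proof. exact: (rmorphM conjc). Qed.

(** The triple product is multiplied by the positive real |l1|^2 |l2|^2 |l3|^2, which leaves the
    argument unchanged. *)
Lemma cartan_scale l1 l2 l3 P1 P2 P3 : l1 != 0 -> l2 != 0 -> l3 != 0 ->
  cartan (l1 *: P1) (l2 *: P2) (l3 *: P3) = cartan P1 P2 P3.
Proof.
move=> h1 h2 h3; rewrite /cartan !(hformZl, hformZr).
have k0 : 0 < sqnorm l1 * sqnorm l2 * sqnorm l3 by rewrite !mulr_gt0 ?sqnorm_gt0.
rewrite -[RHS](carg_scale _ k0); congr carg.
by rewrite 2!realCM -!mulcJ_sqnorm; ring.
Qed.

Lemma invariants_scale l1 l2 l3 l4 P1 P2 P3 P4 : l1 != 0 -> l2 != 0 -> l3 != 0 -> l4 != 0 ->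
  invariants (l1 *: P1) (l2 *: P2) (l3 *: P3) (l4 *: P4) = invariants P1 P2 P3 P4.
Proof. by move=> h1 h2 h3 h4; rewrite /invariants !cross_scale // cartan_scale. Qed.

Definition std z3 w3 z4 w4 (i : nat) : 'cV[C]_3 :=
  nth 0 [:: e1; e3; vec3 z3 w3 1; vec3 z4 w4 1] i.

(** The normalisation |z3| = 1, the nullity of the third and fourth standard lifts, and the
    nonvanishing of the products of the fourth with [e3] and with the third. Up to conjugation, the
    other products of distinct standard lifts are 1 or [z3]. *)
Record admissible z3 w3 z4 w4 : Prop := Admissible {
  adm_unit : z3 * conjc z3 = 1;
  adm_null3 : z3 + conjc z3 + w3 * conjc w3 = 0;
  adm_null4 : z4 + conjc z4 + w4 * conjc w4 = 0;
  adm_z4 : z4 != 0;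
  adm_g43 : z4 + w4 * conjc w3 + conjc z3 != 0 }.

Lemma unit_neq0 z : z * conjc z = 1 -> z != 0.
Proof. by move=> h; apply/eqP => z0; move/eqP: h; rewrite z0 mul0r eq_sym oner_eq0. Qed.

Lemma std_null z3 w3 z4 w4 : admissible z3 w3 z4 w4 ->
  forall i : 'I_4, null_vec (std z3 w3 z4 w4 i).
Proof.
have E z w : hform (vec3 z w 1) (vec3 z w 1) = z + conjc z + w * conjc w.
  by rewrite hform_vec3 rmorph1; ring.
move=> h [[|[|[|[|//]]]] hi]; split; rewrite /= ?vec3_eq0 ?oner_eq0 ?andbF //=.
- by rewrite hform_vec3 rmorph0 rmorph1; ring.
- by rewrite hform_vec3 rmorph0 rmorph1; ring.
- by rewrite E (adm_null3 h).
- by rewrite E (adm_null4 h).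
Qed.

Lemma std_gram z3 w3 z4 w4 : admissible z3 w3 z4 w4 ->
  forall i j : 'I_4, i != j -> hform (std z3 w3 z4 w4 i) (std z3 w3 z4 w4 j) != 0.
Proof.
move=> h i j.
wlog ij : i j / (i < j)%N.
  move=> H; rewrite neq_ltn => /orP[ij|ij]; first by apply: H; rewrite // neq_ltn ij.
  by rewrite -hformC conjc_eq0; apply: H => //; rewrite neq_ltn ij.
move=> _; rewrite -hformC conjc_eq0.
have z30 := unit_neq0 (adm_unit h); have z40 := adm_z4 h; have g := adm_g43 h.
case: i j ij => [[|[|[|[|//]]]] hi] [[|[|[|[|//]]]] hj] //= _.
all: rewrite hform_vec3 ?rmorph0 ?rmorph1 ?mulr0 ?mul0r ?mulr1 ?mul1r.
all: by rewrite ?addr0 ?add0r ?oner_eq0.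
Qed.

Lemma invariants_std z3 w3 z4 w4 :
  invariants (std z3 w3 z4 w4 0) (std z3 w3 z4 w4 1)
    (std z3 w3 z4 w4 2) (std z3 w3 z4 w4 3) =
  (z4 / z3, (z4 + w4 * conjc w3 + conjc z3) / conjc z3, carg (- conjc z3)).
Proof.
rewrite /invariants /cross /cartan /std /= !hform_vec3 !rmorph0 !rmorph1.
by rewrite !(mulr0, mul0r, mulr1, mul1r, addr0, add0r).
Qed.

(* For [t = (X1, X2, A)], the parameters [z3], [z4] of the standard lifts with invariants [t], and
   the squared moduli of [w3], [w4]. *)
Definition std_z3 (t : C * C * R) : C := - expi (- t.2).
Definition std_z4 (t : C * C * R) : C := t.1.1 * std_z3 t.
Definition sqn_w3 (t : C * C * R) : R := 2 * cos t.2.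
Definition sqn_w4 (t : C * C * R) : R := 2 * complex.Re (t.1.1 * expi (- t.2)).

Lemma std_z3J t : conjc (std_z3 t) = - expi t.2.
Proof. by rewrite /std_z3 conjCN expiN conjcK. Qed.

Lemma std_z3_unit t : std_z3 t * conjc (std_z3 t) = 1.
Proof. by rewrite mulcJ_sqnorm sqnormN sqnorm_expi. Qed.

Lemma std_z3_neq0 t : std_z3 t != 0.
Proof. exact: unit_neq0 (std_z3_unit t). Qed.

Lemma addcJE z : z + conjc z = (2 * complex.Re z)%:C%C.
Proof.
case: z => x y; apply/eqP; rewrite eq_complex /=.
by apply/andP; split; apply/eqP; ring.
Qed.

Lemma std_z3_Re t : std_z3 t + conjc (std_z3 t) = - (sqn_w3 t)%:C%C.
Proof. by rewrite addcJE -realCN /std_z3 /= cosN mulrN. Qed.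

Lemma std_z4_Re t : std_z4 t + conjc (std_z4 t) = - (sqn_w4 t)%:C%C.
Proof.
by rewrite addcJE -realCN /std_z4 /std_z3 mulrN (raddfN (@complex.Re R)) /= mulrN.
Qed.

Lemma gram43E t : gram43 t = conjc (std_z3 t) * (t.1.2 - 1) - std_z4 t.
Proof. by rewrite std_z3J /gram43 /std_z4 /std_z3 mulrN opprK. Qed.

Lemma realC_eq (x y : R) : x%:C%C = y%:C%C :> C -> x = y.
Proof. exact: complexI. Qed.

(** As - conj z3 has modulus 1, it is recovered as e^{iA}. Then X1 gives [z4], X2 gives w4 conj w3,
    and nullity gives the moduli of [w3] and [w4]. *)
Lemma admissible_inv_std z3 w3 z4 w4 t : admissible z3 w3 z4 w4 ->
  t = (z4 / z3, (z4 + w4 * conjc w3 + conjc z3) / conjc z3, carg (- conjc z3)) ->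
  [/\ z3 = std_z3 t, z4 = std_z4 t, w4 * conjc w3 = gram43 t,
    w3 * conjc w3 = (sqn_w3 t)%:C%C & w4 * conjc w4 = (sqn_w4 t)%:C%C].
Proof.
move=> h et.
have z30 := unit_neq0 (adm_unit h).
have u3 : sqnorm (- conjc z3) = 1.
  by apply: realC_eq; rewrite sqnormN sqnormJ -mulcJ_sqnorm (adm_unit h).
have E3 : z3 = std_z3 t by rewrite /std_z3 et expiN expi_carg //= conjCN conjcK opprK.
have E4 : z4 = std_z4 t by rewrite /std_z4 -E3 et divfK.
split => //.
- rewrite gram43E -E3 -E4 et /= mulrBr mulr1 [_ * (_ / _)]mulrC divfK ?conjc_eq0 //; ring.
- by have := adm_null3 h; rewrite E3 std_z3_Re addrC => /eqP; rewrite subr_eq0 => /eqP.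
- by have := adm_null4 h; rewrite E4 std_z4_Re addrC => /eqP; rewrite subr_eq0 => /eqP.
Qed.

(** The equation is multiplicativity of the squared modulus applied to w4 conj w3. The bounds on A
    and on Re (X1 e^{-iA}) come from |w3|^2 >= 0 and |w4|^2 >= 0. *)
Lemma std_in_Mset z3 w3 z4 w4 : admissible z3 w3 z4 w4 ->
  Mset (z4 / z3, (z4 + w4 * conjc w3 + conjc z3) / conjc z3, carg (- conjc z3)).
Proof.
move=> h; set t := (X in Mset X).
have [E3 E4 EB a d] := admissible_inv_std h (erefl t).
have z30 := unit_neq0 (adm_unit h).
have a' : sqn_w3 t = sqnorm w3 by apply: realC_eq; rewrite -a mulcJ_sqnorm.
have d' : sqn_w4 t = sqnorm w4 by apply: realC_eq; rewrite -d mulcJ_sqnorm.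
split.
- by rewrite mulf_neq0 ?invr_eq0 ?(adm_z4 h).
- by rewrite mulf_neq0 ?invr_eq0 ?conjc_eq0 ?(adm_g43 h).
- rewrite Mset_eqn -[(_, _, _)]/t -EB -[2 * cos _]/(sqn_w3 t) -[2 * complex.Re _]/(sqn_w4 t).
  by rewrite a' d' sqnormM sqnormJ mulrC subrr.
- apply: carg_bound.
    by apply: realC_eq; rewrite sqnormN sqnormJ -mulcJ_sqnorm (adm_unit h).
  have : complex.Re (- conjc z3) = cos t.2 by rewrite E3 std_z3J opprK.
  by move=> ->; have := sqnorm_ge0 w3; rewrite -a' /sqn_w3; lra.
- by have := sqnorm_ge0 w4; rewrite -d' /sqn_w4; lra.
Qed.

Lemma Mset_sqnorm_gram43 t : Mset t -> sqnorm (gram43 t) = sqn_w3 t * sqn_w4 t.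
Proof.
case: t => [[X1 X2] A] [_ _ h _ _]; move: h; rewrite Mset_eqn => /eqP.
by rewrite subr_eq0 => /eqP.
Qed.

Lemma Mset_sqn_w3_ge0 t : Mset t -> 0 <= sqn_w3 t.
Proof. by move=> [_ _ _ h _]; rewrite mulr_ge0 // cos_half_pi_ge0. Qed.

Lemma Mset_sqn_w4_ge0 t : Mset t -> 0 <= sqn_w4 t.
Proof. by move=> [_ _ _ _ h]; rewrite mulr_ge0. Qed.

(** Any pair with the Gram matrix prescribed by [t] completes [std_z3 t] and [std_z4 t] to standard
    lifts with invariants [t]: the product of the last two lifts is then conj z3 X2, and the bounds
    on A make it the principal argument of e^{iA}. *)
Lemma std_of_Mset t w3 w4 : Mset t -> w3 * conjc w3 = (sqn_w3 t)%:C%C ->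
  w4 * conjc w4 = (sqn_w4 t)%:C%C -> w4 * conjc w3 = gram43 t ->
  admissible (std_z3 t) w3 (std_z4 t) w4 /\
  (std_z4 t / std_z3 t, (std_z4 t + w4 * conjc w3 + conjc (std_z3 t)) / conjc (std_z3 t),
    carg (- conjc (std_z3 t))) = t.
Proof.
move=> [X10 X20 _ hA _] h3 h4 hB.
have c0 : conjc (std_z3 t) != 0 by rewrite conjc_eq0 std_z3_neq0.
have g : std_z4 t + w4 * conjc w3 + conjc (std_z3 t) = conjc (std_z3 t) * t.1.2.
  by rewrite hB gram43E; ring.
split; last first.
  rewrite g [std_z4 _ / _]mulfK ?std_z3_neq0 // [_ * t.1.2]mulrC mulfK //.
  by rewrite std_z3J opprK carg_expi //; case: t {X10 X20 hA h3 h4 hB c0 g} => [[? ?] ?].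
split; rewrite ?std_z3_unit ?std_z3_Re ?std_z4_Re ?h3 ?h4 ?addNr //.
  by rewrite mulf_neq0 ?std_z3_neq0.
by rewrite g mulf_neq0.
Qed.

(** Two pairs with the same Gram matrix differ by a unitary map of C, that is, a phase: w3'/w3 if
    [w3] is nonzero, otherwise w4'/w4 if [w4] is nonzero, otherwise 1. *)
Lemma common_phase w3 w4 w3' w4' :
  w3 * conjc w3 = w3' * conjc w3' -> w4 * conjc w4 = w4' * conjc w4' ->
  w4 * conjc w3 = w4' * conjc w3' ->
  exists u : C, [/\ u * conjc u = 1, w3' = u * w3 & w4' = u * w4].
Proof.
move=> h3 h4 h.
have [w30|w30] := eqVneq w3 0; last first.
  have u1 : w3' / w3 * conjc (w3' / w3) = 1.
    by rewrite conjCM conjc_inv mulrACA -h3 -invfM mulfV // mulf_neq0 ?conjc_eq0.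
  exists (w3' / w3); split => //; first by rewrite divfK.
  have w3'0 : conjc w3' != 0.
    rewrite conjc_eq0; apply/eqP => w0; move/eqP: h3.
    by rewrite w0 mul0r mulf_eq0 conjc_eq0 orbb (negbTE w30).
  apply: (mulIf w3'0); rewrite -h.
  transitivity (w4 / w3 * (w3' * conjc w3')); last by ring.
  by rewrite -h3; field.
have w3'0 : w3' = 0 by apply: conjM_eq0; rewrite -h3 w30 mul0r.
have [w40|w40] := eqVneq w4 0.
  exists 1; rewrite rmorph1 mulr1 w30 w40 w3'0 mulr0; split => //.
  by apply: conjM_eq0; rewrite -h4 w40 mul0r.
exists (w4' / w4); split; last by rewrite divfK.
  by rewrite conjCM conjc_inv mulrACA -h4 -invfM mulfV // mulf_neq0 ?conjc_eq0.
by rewrite w3'0 w30 mulr0.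
Qed.

Lemma std_phase z3 w3 z4 w4 (u : C) : u * conjc u = 1 ->
  exists A, U21 A /\
    forall i : 'I_4, std z3 (u * w3) z4 (u * w4) i = A *m std z3 w3 z4 w4 i.
Proof.
move=> hu; exists (diag3 1 u 1); split; first by apply: U21_diag3; rewrite ?rmorph1 ?mulr1.
by move=> [[|[|[|[|//]]]] hi]; rewrite /= mul_diag3 ?mulr0 ?mul1r.
Qed.

End StandardForm.

(** * Quadruples of boundary points *)

Section Quad.
Variable R : realType.
Local Notation C := R[i].
Local Notation vec := 'cV[C]_3.
Implicit Types (p q : Bdry R) (x y : Conf R).

Lemma lift_null p : null_vec (Defs.lift p).
Proof. exact: set_valP. Qed.

Definition point_of (Z : vec) (hZ : null_vec Z) : Bdry R :=
  (\pi_(Bdry R) (SigSub (mem_set hZ) : null_vec (R := R)))%qT.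

(** This is [maps_to] for arbitrary vectors in place of the chosen representatives, so that those
    can be compared with standard lifts. *)
Definition projects_to (A : 'M[C]_3) (P Q : vec) : Prop :=
  exists l : C, l != 0 /\ Q = l *: (A *m P).

Lemma projects_to_comp A B P Q S :
  projects_to A P Q -> projects_to B Q S -> projects_to (B *m A) P S.
Proof.
move=> [l [l0 ->]] [k [k0 ->]]; exists (k * l); split; first by rewrite mulf_neq0.
by rewrite -scalemxAr scalerA mulmxA.
Qed.

Lemma projects_to_inv A P Q : U21 A -> projects_to A P Q -> projects_to (invmx A) Q P.
Proof.
move=> [uA _] [l [l0 ->]]; exists l^-1; split; first by rewrite invr_eq0.
by rewrite -scalemxAr mulmxA mulVmx // mul1mx scalerA mulVf // scale1r.
Qed.

Lemma lift_point_of Z (hZ : null_vec Z) : projects_to 1%:M Z (Defs.lift (point_of hZ)).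
Proof.
have /esym/(@eqmodP _ (proportional_equiv R)) := reprK (point_of hZ).
by move=> /asboolP [l [l0 e]]; exists l; rewrite mul1mx.
Qed.

Lemma lift_inj p q l : l != 0 -> Defs.lift q = l *: Defs.lift p -> p = q.
Proof.
move=> l0 e; rewrite -(reprK p) -(reprK q).
by apply/(@eqmodP _ (proportional_equiv R))/asboolP; exists l.
Qed.

Lemma lift_gram_neq0 p q : p <> q -> hform (Defs.lift p) (Defs.lift q) != 0.
Proof.
move=> pq; apply/eqP => h; apply: pq.
have [l l0 e] := null_orthogonal (lift_null p) (lift_null q) h.
exact: lift_inj l0 e.
Qed.

Definition lifts (x : Quad R) (i : nat) : vec :=
  nth 0 [:: Defs.lift (q1 x); Defs.lift (q2 x); Defs.lift (q3 x); Defs.lift (q4 x)] i.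

Lemma lifts_null (x : Quad R) (i : 'I_4) : null_vec (lifts x i).
Proof. by case: i => [[|[|[|[|//]]]] hi]; exact: lift_null. Qed.

Lemma lifts_gram x (i j : 'I_4) : i != j -> hform (lifts (val x) i) (lifts (val x) j) != 0.
Proof.
have [n12 [n13 [n14 [n23 [n24 n34]]]]] : distinct4 (val x) by exact: set_valP.
case: i j => [[|[|[|[|//]]]] hi] [[|[|[|[|//]]]] hj] //= _.
all: by apply: lift_gram_neq0 => // /esym.
Qed.

Definition invariants_of (P : nat -> vec) := invariants (P 0) (P 1) (P 2) (P 3).

Lemma invariants_projects_to A (P Q : nat -> vec) : U21 A ->
  (forall i : 'I_4, projects_to A (P i) (Q i)) -> invariants_of Q = invariants_of P.
Proof.
move=> hA h.
have h' (i : nat) (hi : (i < 4)%N) : projects_to A (P i) (Q i) by exact: (h (Ordinal hi)).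
rewrite /invariants_of.
have [l1 [h1 ->]] := h' 0 isT; have [l2 [h2 ->]] := h' 1 isT.
have [l3 [h3 ->]] := h' 2 isT; have [l4 [h4 ->]] := h' 3 isT.
by rewrite invariants_scale // invariants_U21.
Qed.

Lemma pu_relP x y :
  reflect (exists2 A, U21 A &
             forall i : 'I_4, projects_to A (lifts (val x) i) (lifts (val y) i))
          (pu_rel x y).
Proof.
apply: (iffP (asboolP _)) => [[A [hA [h1 h2 h3 h4]]]|[A hA h]]; exists A => //.
  by case=> [[|[|[|[|//]]]] hi].
split=> //; split; [exact: (h (@Ordinal 4 0 isT))|exact: (h (@Ordinal 4 1 isT))|
  exact: (h (@Ordinal 4 2 isT))|exact: (h (@Ordinal 4 3 isT))].
Qed.

Definition tau_quad x := invariants_of (lifts (val x)).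

Lemma tau_quad_pu_rel x y : pu_rel x y -> tau_quad x = tau_quad y.
Proof. by move=> /pu_relP [A hA h]; rewrite /tau_quad (invariants_projects_to hA h). Qed.

(** Nullity and nonvanishing products survive U(2,1) and rescaling, so the normal form of a
    quadruple of distinct points is admissible. *)
Lemma conf_std x : exists A (z3 w3 z4 w4 : C), [/\ U21 A, admissible z3 w3 z4 w4 &
  forall i : 'I_4, projects_to A (lifts (val x) i) (std z3 w3 z4 w4 i)].
Proof.
have [A [z3 [w3 [z4 [w4 [hA z31 h]]]]]] :=
  @normal_form R (fun i => lifts (val x) i) (lifts_null (val x)) (@lifts_gram x).
have h' (i : 'I_4) : projects_to A (lifts (val x) i) (std z3 w3 z4 w4 i).
  by have [l l0 e] := h i; exists l.
exists A, z3, w3, z4, w4; split => //.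
have g (i j : 'I_4) : i != j -> hform (std z3 w3 z4 w4 i) (std z3 w3 z4 w4 j) != 0.
  move=> ij; have [l [l0 ->]] := h' i; have [k [k0 ->]] := h' j.
  by rewrite hformZl hformZr !mulf_neq0 ?conjc_eq0 // hform_U21 // lifts_gram.
have n (i : 'I_4) : hform (std z3 w3 z4 w4 i) (std z3 w3 z4 w4 i) = 0.
  have [l [l0 ->]] := h' i; rewrite hformZl hformZr hform_U21 //.
  by have [_ ->] := lifts_null (val x) i; rewrite !mulr0.
have E z w z' w' : hform (vec3 z w 1) (vec3 z' w' 1) = z + w * conjc w' + conjc z' :> C.
  by rewrite hform_vec3 rmorph1; ring.
split => //.
- by have := n (@Ordinal 4 2 isT); rewrite E => <-; ring.
- by have := n (@Ordinal 4 3 isT); rewrite E => <-; ring.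
- have := g (@Ordinal 4 3 isT) (@Ordinal 4 1 isT) isT; rewrite hform_vec3.
  by rewrite !rmorph0 rmorph1 !mulr0 mulr1 !addr0.
- by have := g (@Ordinal 4 3 isT) (@Ordinal 4 2 isT) isT; rewrite E.
Qed.

Lemma tau_quad_Mset x : Mset (tau_quad x).
Proof.
have [A [z3 [w3 [z4 [w4 [hA adm h]]]]]] := conf_std x.
rewrite /tau_quad -(invariants_projects_to hA h) [invariants_of _]invariants_std.
exact: std_in_Mset.
Qed.

(** Let A and B bring x and y to standard form. Equal invariants give equal z3, z4 and equal Gram
    matrices of (w3, w4), so the two forms differ by some D = diag(1,u,1), and B^-1 D A carries x to
    y. *)
Lemma tau_quad_inj x y : tau_quad x = tau_quad y -> pu_rel x y.
Proof.
have [A [z3 [w3 [z4 [w4 [hA adm h]]]]]] := conf_std x.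
have [B [z3' [w3' [z4' [w4' [hB adm' h']]]]]] := conf_std y.
move=> exy.
have ex : tau_quad x = _ := esym (invariants_projects_to hA h).
have ey : tau_quad y = _ := esym (invariants_projects_to hB h').
rewrite [invariants_of _]invariants_std in ex.
rewrite [invariants_of _]invariants_std -exy in ey.
have [E3 E4 EB a d] := admissible_inv_std adm ex.
have [E3' E4' EB' a' d'] := admissible_inv_std adm' ey.
have [|||u [u1 e3 e4]] := @common_phase R w3 w4 w3' w4'.
- by rewrite a a'.
- by rewrite d d'.
- by rewrite EB EB'.
have [D [hD eD]] := std_phase z3 w3 z4 w4 u1.
apply/pu_relP; exists (invmx B *m (D *m A)).
  by apply: U21_mul; [exact: U21_inv | exact: U21_mul].
move=> i; apply: projects_to_comp (projects_to_inv hB (h' i)).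
apply: projects_to_comp (h i) _; exists 1; rewrite oner_neq0 scale1r -eD.
by rewrite E3' E4' -E3 -E4 e3 e4.
Qed.

(** * Configurations with prescribed lifts *)

Section QuadOf.
Variable P : nat -> vec.
Hypothesis nP : forall i : 'I_4, null_vec (P i).
Hypothesis gP : forall i j : 'I_4, i != j -> hform (P i) (P j) != 0.
Let pt k (hk : (k < 4)%N) := point_of (nP (Ordinal hk)).

Definition quad_of : Quad R :=
  (@pt 0 isT, @pt 1 isT, @pt 2 isT, @pt 3 isT).

(** If two of the points coincided, their lifts would be proportional null vectors, with product
    zero. *)
Lemma quad_of_distinct : distinct4 quad_of.
Proof.
have D i j (hi : (i < 4)%N) (hj : (j < 4)%N) : i != j -> pt hi <> pt hj.
  move=> ij e.
  have [l [l0 el]] := lift_point_of (nP (Ordinal hi)).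
  have [k [k0 ek]] := lift_point_of (nP (Ordinal hj)).
  have := gP (i := Ordinal hi) (j := Ordinal hj) ij; apply/negP; rewrite negbK.
  have : hform (Defs.lift (pt hi)) (Defs.lift (pt hj)) = 0.
    by rewrite e; case: (lift_null (pt hj)).
  rewrite /pt el ek !mul1mx hformZl hformZr => /eqP.
  by rewrite !mulf_eq0 conjc_eq0 (negbTE l0) (negbTE k0).
by do !split; apply: D.
Qed.

Definition conf_of : Conf R := SigSub (mem_set quad_of_distinct).

Lemma lifts_conf_of (i : 'I_4) : projects_to 1%:M (P i) (lifts (val conf_of) i).
Proof.
case: i => [[|[|[|[|//]]]] hi]; rewrite (bool_irrelevance hi isT) /=;
  exact: lift_point_of.
Qed.

Lemma tau_conf_of : tau_quad conf_of = invariants_of P.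
Proof. exact: invariants_projects_to (@U21_1 R) lifts_conf_of. Qed.

End QuadOf.

Definition std_conf z3 w3 z4 w4 (h : admissible z3 w3 z4 w4) : Conf R :=
  conf_of (std_null h) (std_gram h).

(* A complex number of squared modulus [d] whose product with [Num.sqrt a] is [B]; this makes sense
   only when [a, d >= 0] and [sqnorm B = a * d]. *)
Definition phase_w (a d : R) (B : C) : C :=
  if a == 0 then (Num.sqrt d)%:C%C else B / (Num.sqrt a)%:C%C.

Lemma sqrtC_J (a : R) : 0 <= a -> (Num.sqrt a)%:C%C * conjc (Num.sqrt a)%:C%C = a%:C%C :> C.
Proof. by move=> a0; rewrite conjc_real -realCM -expr2 sqr_sqrtr. Qed.

(** If a = 0 then B = 0, and any number of squared modulus d works. Otherwise |B|^2 / a = d. *)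
Lemma phase_wP a d B : 0 <= a -> 0 <= d -> sqnorm B = a * d ->
  phase_w a d B * conjc (phase_w a d B) = d%:C%C /\
  phase_w a d B * conjc (Num.sqrt a)%:C%C = B.
Proof.
rewrite /phase_w => a0 d0 hB; case: eqVneq => [az|anz].
  rewrite sqrtC_J // az sqrtr0 rmorph0 mulr0; split => //.
  by apply/esym/conjM_eq0; rewrite mulcJ_sqnorm hB az mul0r.
have s0 : (Num.sqrt a)%:C%C != 0 :> C.
  rewrite -(rmorph0 (real_complex R)) (inj_eq (@complexI R)).
  by rewrite gt_eqF // sqrtr_gt0 lt_def anz.
split; last by rewrite conjc_real divfK.
rewrite conjCM conjc_inv mulrACA -invfM sqrtC_J // mulcJ_sqnorm hB realCM mulrAC.
rewrite mulfV ?mul1r //.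
by rewrite -(rmorph0 (real_complex R)) (inj_eq (@complexI R)).
Qed.

(** The pair (w3, w4) whose phase is fixed by w3 >= 0. In [w4_first] it is fixed by w4 >= 0, so the
    two moduli exchange roles and the mixed product is conjugated. *)
Definition w3_first (t : C * C * R) : C * C :=
  ((Num.sqrt (sqn_w3 t))%:C%C, phase_w (sqn_w3 t) (sqn_w4 t) (gram43 t)).
Definition w4_first (t : C * C * R) : C * C :=
  (phase_w (sqn_w4 t) (sqn_w3 t) (conjc (gram43 t)), (Num.sqrt (sqn_w4 t))%:C%C).

(** What both choices of phase have in common, so that the inverse of [tau] can be built from
    either. *)
Definition gram_section (s : C * C * R -> C * C) := forall t, Mset t ->
  [/\ (s t).1 * conjc (s t).1 = (sqn_w3 t)%:C%C,
      (s t).2 * conjc (s t).2 = (sqn_w4 t)%:C%C &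
      (s t).2 * conjc (s t).1 = gram43 t].

Lemma w3_first_gram : gram_section w3_first.
Proof.
move=> t ht; have [h1 h2] :=
  phase_wP (Mset_sqn_w3_ge0 ht) (Mset_sqn_w4_ge0 ht) (Mset_sqnorm_gram43 ht).
by split; [exact: sqrtC_J (Mset_sqn_w3_ge0 ht)|exact: h1|exact: h2].
Qed.

Lemma w4_first_gram : gram_section w4_first.
Proof.
move=> t ht; have hB : sqnorm (conjc (gram43 t)) = sqn_w4 t * sqn_w3 t.
  by rewrite sqnormJ (Mset_sqnorm_gram43 ht) mulrC.
have [h1 h2] := phase_wP (Mset_sqn_w4_ge0 ht) (Mset_sqn_w3_ge0 ht) hB.
split; [exact: h1|exact: sqrtC_J (Mset_sqn_w4_ge0 ht)|].
by rewrite -[RHS]conjcK -h2 conjCM conjcK mulrC.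
Qed.

Lemma section_admissible s t : gram_section s -> Mset t ->
  admissible (std_z3 t) (s t).1 (std_z4 t) (s t).2.
Proof. by move=> hs ht; have [h3 h4 hB] := hs t ht; have [] := std_of_Mset ht h3 h4 hB. Qed.

Definition section_conf s (hs : gram_section s) t (ht : Mset t) : Conf R :=
  std_conf (section_admissible hs ht).

Lemma tau_section_conf s (hs : gram_section s) t (ht : Mset t) :
  tau_quad (section_conf hs ht) = t.
Proof.
rewrite tau_conf_of [invariants_of _]invariants_std.
by have [h3 h4 hB] := hs t ht; have [] := std_of_Mset ht h3 h4 hB.
Qed.

End Quad.

(** * Continuity of the invariants *)

Section ContinuityOfArg.
Variable R : realType.
Local Notation C := R[i].
Implicit Types (z : C).

Lemma continuous_sqnorm : continuous (@sqnorm R).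
Proof.
move=> z; rewrite /sqnorm; under eq_fun do rewrite !expr2.
have cR := @continuous_Re R z; have cI := @continuous_Im R z.
exact: (cvgD (cvgM cR cR) (cvgM cI cI)).
Qed.

Lemma continuous_div_norm (f : C -> R) z : z != 0 -> {for z, continuous f} ->
  {for z, continuous (fun z => f z / Num.sqrt (sqnorm z))}.
Proof.
move=> z0 cf; have s0 : Num.sqrt (sqnorm z) != 0 by rewrite gt_eqF // sqrtr_gt0 sqnorm_gt0.
have cs : {for z, continuous (fun z => Num.sqrt (sqnorm z))}.
  exact: (@continuous_comp _ _ _ _ _ z (@continuous_sqnorm z) (@sqrt_continuous _ _)).
exact: (cvgM cf (cvgV s0 cs)).
Qed.

Lemma unit_part z : z != 0 ->
  (complex.Re z / Num.sqrt (sqnorm z)) ^+ 2 + (complex.Im z / Num.sqrt (sqnorm z)) ^+ 2 = 1.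
Proof.
by move=> z0; rewrite !expr_div_n -mulrDl sqr_sqrtr ?sqnorm_ge0 // divff // gt_eqF // sqnorm_gt0.
Qed.

Lemma cos_carg z : z != 0 -> cos (carg z) = complex.Re z / Num.sqrt (sqnorm z).
Proof.
move=> z0; have h := unit_circle_itv (unit_part z0).
by rewrite /carg; case: ifP => _; rewrite ?cosN acosK // in_itv.
Qed.

(** After rescaling to modulus 1, the imaginary part is the sine of [carg z], which lies in
    [-pi/2, pi/2], where [asin] inverts the sine. *)
Lemma cargE_asin z : 0 < complex.Re z -> carg z = asin (complex.Im z / Num.sqrt (sqnorm z)).
Proof.
move=> x0; have z0 : z != 0 by apply: contraTneq x0 => ->; rewrite ltxx.
set r := Num.sqrt _; have r0 : 0 < r^-1 by rewrite invr_gt0 sqrtr_gt0 sqnorm_gt0.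
have ImE : complex.Im ((r^-1)%:C%C * z) = complex.Im z / r.
  by case: z {x0 z0 r0} @r => x y r /=; ring.
have ReE : complex.Re ((r^-1)%:C%C * z) = complex.Re z / r.
  by case: z {x0 z0 r0 ImE} @r => x y r /=; ring.
have u : sqnorm ((r^-1)%:C%C * z) = 1 by rewrite /sqnorm ReE ImE unit_part.
rewrite -ImE -(carg_scale z r0) -[X in asin (complex.Im X)]expi_carg // sinK // in_itv /=.
by apply: carg_bound; rewrite // ReE mulr_ge0 // ltW.
Qed.

Lemma unit_circle_itv_strict (a b : R) : a ^+ 2 + b ^+ 2 = 1 -> b != 0 -> -1 < a < 1.
Proof.
move=> h b0; have : 0 < b ^+ 2 by rewrite exprn_even_gt0.
by move=> b2; apply/andP; split; nra.
Qed.

(* [acos] is only known to be continuous on ]-1, 1[, so near the positive real axis [carg] is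
   rewritten as an [asin]. *)
Lemma continuous_carg z : 0 <= complex.Re z -> z != 0 -> {for z, continuous (@carg R)}.
Proof.
move=> x0 z0; have u := unit_part z0.
have s0 : 0 < Num.sqrt (sqnorm z) by rewrite sqrtr_gt0 sqnorm_gt0.
have cR := continuous_div_norm z0 (@continuous_Re R z).
have cI := continuous_div_norm z0 (@continuous_Im R z).
have ca : complex.Im z != 0 ->
    {for z, continuous (fun w => acos (complex.Re w / Num.sqrt (sqnorm w)))}.
  move=> y0; apply: (@continuous_comp _ _ _
    (fun w => complex.Re w / Num.sqrt (sqnorm w)) (@acos R) z cR).
  apply: continuous_acos; apply: (unit_circle_itv_strict u).
  by rewrite mulf_neq0 // invr_eq0 (gt_eqF s0).
have [y0|y0|y0] := ltgtP (complex.Im z) 0.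
- apply: (@near_eq_continuous _ _ _ _ (fun w => - acos (complex.Re w / Num.sqrt (sqnorm w)))).
    have : \forall w \near z, complex.Im w < 0 by exact: (cvgr_lt _ (@continuous_Im R z)).
    by apply: filterS => w w0; rewrite /carg leNgt w0.
  by have /ca /cvgN : complex.Im z != 0 by rewrite lt_eqF.
- apply: (@near_eq_continuous _ _ _ _ (fun w => acos (complex.Re w / Num.sqrt (sqnorm w)))).
    have : \forall w \near z, 0 < complex.Im w by exact: (cvgr_gt _ (@continuous_Im R z)).
    by apply: filterS => w w0; rewrite /carg ltW.
  by apply: ca; rewrite gt_eqF.
(* On the real axis a nonzero z with Re z >= 0 is positive, so the formula with [asin] applies
   nearby. *)
have {}x0 : 0 < complex.Re z.
  rewrite lt_def x0 andbT; apply: contra_neq z0 => x0'; apply/eqP.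
  by rewrite eq_complex x0' y0 /= !eqxx.
apply: (@near_eq_continuous _ _ _ _ (fun w => asin (complex.Im w / Num.sqrt (sqnorm w)))).
  have : \forall w \near z, 0 < complex.Re w by exact: (cvgr_gt _ (@continuous_Re R z)).
  by apply: filterS => w w0; rewrite cargE_asin.
apply: (@continuous_comp _ _ _ (fun w => complex.Im w / Num.sqrt (sqnorm w)) (@asin R) z cI).
apply: continuous_asin.
by rewrite y0 mul0r; apply/andP; split; lra.
Qed.

(** The sign of Re z is that of cos (carg z). This turns the bound on A in M into the hypothesis of
    [continuous_carg]. *)
Lemma Re_ge0_carg z : z != 0 -> - (trigo.pi / 2) <= carg z <= trigo.pi / 2 -> 0 <= complex.Re z.
Proof.
move=> z0 /cos_half_pi_ge0; rewrite cos_carg // pmulr_lge0 // invr_gt0 sqrtr_gt0.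
by rewrite sqnorm_gt0.
Qed.

End ContinuityOfArg.

(** * Continuous local lifts of boundary points *)

Section LocalLift.
Variable R : realType.
Local Notation C := R[i].
Local Notation vec := 'cV[C]_3.
Local Notation o0 := (@Ordinal 3 0 isT).
Local Notation o1 := (@Ordinal 3 1 isT).
Local Notation o2 := (@Ordinal 3 2 isT).

Section At.
Variables (T : topologicalType) (x : T).

Lemma cont_coord (Z : T -> vec) i :
  {for x, continuous Z} -> {for x, continuous (fun t => Z t i ord0)}.
Proof.
move=> cZ; exact: (@continuous_comp _ _ _ Z (fun W : vec => W i ord0) x cZ
  (@coord_continuous _ _ _ i ord0 _)).
Qed.

Lemma cont_vec3 (a b c : T -> C) :
  {for x, continuous a} -> {for x, continuous b} -> {for x, continuous c} ->
  {for x, continuous (fun t => vec3 (a t) (b t) (c t))}.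
Proof.
move=> ca cb cc; apply: continuous_mx_at => i j; rewrite ord1; move: i; apply: ord3P.
- by apply: eq_continuous_at ca => t; rewrite mxE.
- by apply: eq_continuous_at cb => t; rewrite mxE.
- by apply: eq_continuous_at cc => t; rewrite mxE.
Qed.

Lemma cont_hform (Z W : T -> vec) : {for x, continuous Z} -> {for x, continuous W} ->
  {for x, continuous (fun t => hform (Z t) (W t))}.
Proof.
move=> cZ cW.
apply: (@eq_continuous_at _ _ _ (fun t => Z t o0 ord0 * conjc (W t o2 ord0) +
    Z t o1 ord0 * conjc (W t o1 ord0) + Z t o2 ord0 * conjc (W t o0 ord0))).
  by move=> t; rewrite {1}[Z t]vec3_eta {1}[W t]vec3_eta hform_vec3.
have c (i : 'I_3) := contC_conj (@cont_coord W i cW).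
have d (i : 'I_3) := @cont_coord Z i cZ.
exact: (contC_add (contC_add (contC_mul (d o0) (c o2)) (contC_mul (d o1) (c o1)))
  (contC_mul (d o2) (c o0))).
Qed.

Lemma near_neq0 (f : T -> C) :
  {for x, continuous f} -> f x != 0 -> \forall t \near x, f t != 0.
Proof.
move=> cf fx; have cs := @continuous_comp _ _ _ f (@sqnorm R) x cf (@continuous_sqnorm R _).
have fx' : 0 < sqnorm (f x) by rewrite sqnorm_gt0.
have : \forall t \near x, 0 < sqnorm (f t) by exact: (cvgr_gt _ cs).
by apply: filterS => t; rewrite sqnorm_gt0.
Qed.

End At.

(** The standard positive definite product: unlike [hform], it does not vanish at (Z, Z) for a
    nonzero null vector Z. *)
Definition eucl (Z W : vec) : C :=
  Z o0 ord0 * conjc (W o0 ord0) + Z o1 ord0 * conjc (W o1 ord0) + Z o2 ord0 * conjc (W o2 ord0).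

Lemma euclZl (l : C) Z W : eucl (l *: Z) W = l * eucl Z W.
Proof. by rewrite /eucl !mxE; ring. Qed.

Lemma euclZr (l : C) Z W : eucl Z (l *: W) = conjc l * eucl Z W.
Proof. by rewrite /eucl !mxE !conjCM; ring. Qed.

Lemma eucl_eq0 Z : (eucl Z Z == 0) = (Z == 0).
Proof.
have D (a b : R) : a%:C%C + b%:C%C = (a + b)%:C%C :> C by rewrite (rmorphD (real_complex R)).
have R0 (a : R) : (a%:C%C == 0 :> C) = (a == 0) by exact: (inj_eq (@complexI R) a 0).
rewrite /eucl !mulcJ_sqnorm !D R0.
have p (a : 'I_3) := sqnorm_ge0 (Z a ord0).
rewrite paddr_eq0 ?(addr_ge0 (p _) (p _)) // paddr_eq0 // [X in _ = (X == 0)]vec3_eta vec3_eq0.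
have E (z : C) : (sqnorm z == 0) = (z == 0).
  by rewrite -[RHS]negbK -sqnorm_gt0 lt_def sqnorm_ge0 andbT negbK.
by rewrite !E andbA.
Qed.

(* The Euclidean projection of [v] to the line of [Z] depends only on that line, and is a lift of
   it when it is nonzero; [Defs.lift] itself is not continuous. *)
Definition local_lift (v Z : vec) : vec := (eucl v Z / eucl Z Z) *: Z.

Lemma local_liftZ v Z (l : C) : l != 0 -> local_lift v (l *: Z) = local_lift v Z.
Proof.
move=> l0; rewrite /local_lift euclZl !euclZr scalerA; congr (_ *: Z).
(* The inverse of 0 is 0, so in this case both coefficients vanish. *)
have [Z0|Z0] := eqVneq (eucl Z Z) 0; first by rewrite Z0 !mulr0 invr0 !mulr0 mul0r.
have l0' : conjc l != 0 by rewrite conjc_eq0.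
by field; rewrite l0 l0' Z0.
Qed.

Lemma local_lift_id Z : Z != 0 -> local_lift Z Z = Z.
Proof. by move=> Z0; rewrite /local_lift divff ?scale1r // eucl_eq0. Qed.

Lemma continuous_eucl (T : topologicalType) x (Z W : T -> vec) :
  {for x, continuous Z} -> {for x, continuous W} ->
  {for x, continuous (fun t => eucl (Z t) (W t))}.
Proof.
move=> cZ cW; have c (i : 'I_3) := contC_conj (@cont_coord _ _ W i cW).
have d (i : 'I_3) := @cont_coord _ _ Z i cZ.
exact: (contC_add (contC_add (contC_mul (d o0) (c o0)) (contC_mul (d o1) (c o1)))
  (contC_mul (d o2) (c o2))).
Qed.

Lemma continuous_local_lift v (Z : vec) : Z != 0 -> {for Z, continuous (local_lift v)}.
Proof.
move=> Z0; have cid : {for Z, continuous (fun W : vec => W)} by exact: cvg_id.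
have cv : {for Z, continuous (fun W : vec => v)}.
  exact: (@cst_continuous _ _ v Z).
have ck : {for Z, continuous (fun W : vec => eucl v W / eucl W W)}.
  apply: (contC_div (continuous_eucl cv cid) (continuous_eucl cid cid)).
  by rewrite eucl_eq0.
apply: continuous_mx_at => i j; rewrite ord1.
apply: (@eq_continuous_at _ _ _ (fun W : vec => eucl v W / eucl W W * W i ord0)).
  by move=> W; rewrite mxE.
exact: (contC_mul ck (@cont_coord _ _ id i cid)).
Qed.

(** [local_lift v] is continuous on nonzero vectors and constant on each line, hence it descends to
    a continuous map on the quotient. *)
Lemma continuous_local_lift_Bdry v : continuous (local_lift v \o @Defs.lift R).
Proof.
apply: (@repr_comp_continuous _ {eq_quot (@proportional R)}%qT vec
  (fun u : null_vec (R := R) => local_lift v (val u))).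
  move=> u; apply: (@continuous_comp _ _ _ (val : null_vec (R := R) -> vec) (local_lift v)).
    exact: initial_continuous.
  by apply: continuous_local_lift; have [] := set_valP u.
move=> u w /eqP /(@eqmodP _ (proportional_equiv R)) /asboolP [l [l0 ->]].
by rewrite local_liftZ.
Qed.

End LocalLift.

(** * Continuity of [tau], and of configurations in terms of lifts *)

Section ContinuityOfTau.
Variable R : realType.
Local Notation C := R[i].
Local Notation vec := 'cV[C]_3.

(** The fourth point serves as the default value of [nth], which makes every index meaningful. *)
Definition pts (x : Conf R) (i : nat) : Bdry R :=
  nth (q4 (val x)) [:: q1 (val x); q2 (val x); q3 (val x)] i.

Lemma continuous_pts i : continuous (pts^~ i).
Proof.
have cval : continuous (val : Conf R -> Quad R) by exact: initial_continuous.
have c1 : continuous (fst : Quad R -> _) by move=> ?; exact: cvg_fst.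
have c11 : continuous (fst : (Bdry R * Bdry R * Bdry R) -> _) by move=> ?; exact: cvg_fst.
have c111 : continuous (fst : (Bdry R * Bdry R) -> _) by move=> ?; exact: cvg_fst.
have c112 : continuous (snd : (Bdry R * Bdry R) -> _) by move=> ?; exact: cvg_snd.
have c12 : continuous (snd : (Bdry R * Bdry R * Bdry R) -> _) by move=> ?; exact: cvg_snd.
have c2 : continuous (snd : Quad R -> _) by move=> ?; exact: cvg_snd.
case: i => [|[|[|i]]] x.
- exact: (continuous_comp (continuous_comp (continuous_comp (cval x) (c1 _)) (c11 _)) (c111 _)).
- exact: (continuous_comp (continuous_comp (continuous_comp (cval x) (c1 _)) (c11 _)) (c112 _)).
- exact: (continuous_comp (continuous_comp (cval x) (c1 _)) (c12 _)).
- rewrite (_ : pts^~ _ = fun x => q4 (val x)); last first.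
    by apply/funext => y; rewrite /pts nth_default.
  exact: (continuous_comp (cval x) (c2 _)).
Qed.

Lemma lifts_pts x (i : 'I_4) : lifts (val x) i = Defs.lift (pts x i).
Proof. by case: i => [[|[|[|[|//]]]] hi]. Qed.

Lemma hform_scale_neq0 (k l : C) (Z W : vec) : hform (k *: Z) (l *: W) != 0 -> k != 0 /\ l != 0.
Proof.
rewrite hformZl hformZr => h; split; apply: contra_neq h => ->; first by rewrite mul0r.
by rewrite conjc0 mul0r mulr0.
Qed.

(** Near [x0] the representatives are replaced by local lifts centred at those of [x0]. These vary
    continuously and differ from the representatives by nonzero scalars, so the invariants are the
    same. *)
Lemma continuous_tau_quad : continuous (@tau_quad R).
Proof.
move=> x0.
pose S (x : Conf R) (i : nat) := local_lift (Defs.lift (pts x0 i)) (Defs.lift (pts x i)).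
have S0 i : S x0 i = Defs.lift (pts x0 i).
  by apply: local_lift_id; have [] := lift_null (pts x0 i).
have cS i : {for x0, continuous (S^~ i)}.
  exact: (continuous_comp (@continuous_pts i x0) (@continuous_local_lift_Bdry R _ _)).
have cH i j : {for x0, continuous (fun x => hform (S x i) (S x j))} by exact: cont_hform.
have S0E (i : 'I_4) : S x0 i = lifts (val x0) i by rewrite lifts_pts S0.
have gS (i j : 'I_4) : i != j -> hform (S x0 i) (S x0 j) != 0.
  by move=> ij; rewrite !S0E lifts_gram.
have h (i j : nat) (hi : (i < 4)%N) (hj : (j < 4)%N) :
    i != j -> hform (S x0 i) (S x0 j) != 0.
  by move=> ij; exact: (gS (Ordinal hi) (Ordinal hj)).
have E : {near x0, @tau_quad R =1 fun x => invariants_of (S x)}.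
  (* Each of the four indices occurs in one of these two products, so their nonvanishing makes all
     four scalars nonzero. *)
  have n01 := near_neq0 (cH 0 1) (h 0 1 isT isT isT).
  have n23 := near_neq0 (cH 2 3) (h 2 3 isT isT isT).
  apply: filterS2 n01 n23 => x /hform_scale_neq0[k0 k1] /hform_scale_neq0[k2 k3].
  exact: (esym (invariants_scale _ _ _ _ k0 k1 k2 k3)).
apply: (near_eq_continuous E).
have c1 : {for x0, continuous (fun x => cross (S x 0) (S x 1) (S x 2) (S x 3))}.
  apply: (contC_div (contC_mul (cH 2 0) (cH 3 1)) (contC_mul (cH 3 0) (cH 2 1))).
  by rewrite mulf_neq0 ?h.
have c2 : {for x0, continuous (fun x => cross (S x 0) (S x 2) (S x 1) (S x 3))}.
  apply: (contC_div (contC_mul (cH 1 0) (cH 3 2)) (contC_mul (cH 3 0) (cH 1 2))).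
  by rewrite mulf_neq0 ?h.
have c3 : {for x0, continuous (fun x => cartan (S x 0) (S x 1) (S x 2))}.
  have cz := contC_opp (contC_mul (contC_mul (cH 0 1) (cH 1 2)) (cH 2 0)).
  have z0 : - (hform (S x0 0) (S x0 1) * hform (S x0 1) (S x0 2) * hform (S x0 2) (S x0 0)) != 0.
    by rewrite oppr_eq0 !mulf_neq0 ?h.
  (* Membership in M at [x0] keeps the triple product off the cut of the argument. *)
  have [_ _ _ A0 _] := tau_quad_Mset x0; rewrite (nbhs_singleton E) in A0.
  have cc := continuous_carg (Re_ge0_carg z0 A0) z0.
  exact: (@continuous_comp _ _ _ _ (@carg R) x0 cz cc).
exact: (continuous_pair_at (continuous_pair_at c1 c2) c3).
Qed.

Lemma continuous_tau : continuous (@tau R).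
Proof.
apply: (@repr_comp_continuous _ {eq_quot (@pu_rel R)}%qT _ (@tau_quad R)).
  exact: continuous_tau_quad.
by move=> x y /eqP /(@eqmodP _ (pu_equiv R)) h; apply/eqP; exact: tau_quad_pu_rel.
Qed.

Lemma continuous_point_of (T : topologicalType) (Z : T -> vec) (hZ : forall t, null_vec (Z t)) t0 :
  {for t0, continuous Z} -> {for t0, continuous (fun t => point_of (hZ t))}.
Proof.
move=> cZ.
have c : {for t0, continuous (fun t => SigSub (mem_set (hZ t)) : null_vec (R := R))}.
  by exact: continuous_initial_at.
exact: (continuous_comp c (@pi_continuous _ {eq_quot (@proportional R)}%qT _)).
Qed.

Lemma continuous_conf_of (T : topologicalType) (P : T -> nat -> vec)
  (nP : forall t (i : 'I_4), null_vec (P t i))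
  (gP : forall t (i j : 'I_4), i != j -> hform (P t i) (P t j) != 0) t0 :
  (forall i : nat, {for t0, continuous (P^~ i)}) ->
  {for t0, continuous (fun t => conf_of (nP t) (gP t))}.
Proof.
move=> cP; apply: continuous_initial_at.
have c (i : 'I_4) := @continuous_point_of T (P^~ i) (fun t => nP t i) t0 (cP i).
exact: (continuous_pair_at (continuous_pair_at (continuous_pair_at (c _) (c _)) (c _)) (c _)).
Qed.

End ContinuityOfTau.

(** * Continuity of the inverse *)

Section Sections.
Variable R : realType.
Local Notation C := R[i].

(** Where a is nonzero the value is locally the quotient B / sqrt a. Where d vanishes, the modulus
    sqrt d tends to 0, so the value does too, whatever its phase. *)
Lemma continuous_phase_w (T : topologicalType) (a d : T -> R) (B : T -> C) x :
  {for x, continuous a} -> {for x, continuous d} -> {for x, continuous B} ->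
  (forall t, [/\ 0 <= a t, 0 <= d t & sqnorm (B t) = a t * d t]) ->
  a x != 0 \/ d x = 0 -> {for x, continuous (fun t => phase_w (a t) (d t) (B t))}.
Proof.
move=> ca cd cB h [a0|d0].
  have na : \forall t \near x, a t != 0 by exact: (cvgr_neq0 _ ca a0).
  apply: (@near_eq_continuous _ _ _ _ (fun t => B t / (Num.sqrt (a t) +i* 0)%C)).
    by apply: filterS na => t /negbTE t0; rewrite /phase_w t0.
  have cs : {for x, continuous (fun t => Num.sqrt (a t))}.
    exact: (continuous_comp ca (@sqrt_continuous R _)).
  apply: (contC_div cB (contC_cplx cs (@cst_continuous _ _ 0 x))).
  have [ax _ _] := h x.
  by rewrite eq_complex /= eqxx andbT gt_eqF // sqrtr_gt0 lt_def a0.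
have E t : sqnorm (phase_w (a t) (d t) (B t)) = d t.
  have [a1 d1 hB] := h t; have [hp _] := phase_wP a1 d1 hB.
  by apply: realC_eq; rewrite -mulcJ_sqnorm.
have px : phase_w (a x) (d x) (B x) = 0.
  by apply: conjM_eq0; rewrite mulcJ_sqnorm E d0.
rewrite /prop_for /continuous_at px; apply/cvgC_dist => e e0.
have cs : {for x, continuous (fun t => Num.sqrt (d t))}.
  exact: (continuous_comp cd (@sqrt_continuous R _)).
have : \forall t \near x, Num.sqrt (d t) < e.
  by apply: (cvgr_lt _ cs); rewrite d0 sqrtr0.
apply: filterS => t dt.
by rewrite sub0r normrN normc_def -[_ + _]/(sqnorm _) E ltcR.
Qed.

Local Notation M := (set_type (@Mset R)).

Lemma continuous_Mset_val : continuous (val : M -> C * C * R).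
Proof. exact: initial_continuous. Qed.

Section AtPoint.
Variable t0 : M.

Let cX1 : {for t0, continuous (fun t : M => (val t).1.1)}.
Proof.
exact: (continuous_comp (continuous_comp (@continuous_Mset_val t0) (@cvg_fst _ _ _ _ _))
  (@cvg_fst _ _ _ _ _)).
Qed.

Let cX2 : {for t0, continuous (fun t : M => (val t).1.2)}.
Proof.
exact: (continuous_comp (continuous_comp (@continuous_Mset_val t0) (@cvg_fst _ _ _ _ _))
  (@cvg_snd _ _ _ _ _)).
Qed.

Let cA : {for t0, continuous (fun t : M => (val t).2)}.
Proof. exact: (continuous_comp (@continuous_Mset_val t0) (@cvg_snd _ _ _ _ _)). Qed.

Let cexpi : {for t0, continuous (fun t : M => expi (val t).2)}.
Proof.
exact: (contC_cplx (continuous_comp cA (@continuous_cos R _))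
  (continuous_comp cA (@continuous_sin R _))).
Qed.

Let cexpiN : {for t0, continuous (fun t : M => expi (- (val t).2))}.
Proof. by apply: eq_continuous_at (contC_conj cexpi) => t; rewrite expiN. Qed.

Lemma continuous_std_z3 : {for t0, continuous (fun t : M => std_z3 (val t))}.
Proof. exact: (contC_opp cexpiN). Qed.

Lemma continuous_std_z4 : {for t0, continuous (fun t : M => std_z4 (val t))}.
Proof. exact: (contC_mul cX1 continuous_std_z3). Qed.

Lemma continuous_gram43 : {for t0, continuous (fun t : M => gram43 (val t))}.
Proof.
exact: (contC_add (contC_mul (contC_opp cexpi) (contC_add cX2 (@contC_cst R M t0 (-1))))
  (contC_mul cX1 cexpiN)).
Qed.

Lemma continuous_sqn_w3 : {for t0, continuous (fun t : M => sqn_w3 (val t))}.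
Proof. exact: (cvgM (@cst_continuous M R 2 t0) (continuous_comp cA (@continuous_cos R _))). Qed.

Lemma continuous_sqn_w4 : {for t0, continuous (fun t : M => sqn_w4 (val t))}.
Proof. exact: (cvgM (@cst_continuous M R 2 t0) (contC_Re (contC_mul cX1 cexpiN))). Qed.

Lemma continuous_w3_first : sqn_w4 (val t0) = 0 ->
  {for t0, continuous (fun t : M => w3_first (val t))}.
Proof.
move=> h; apply: continuous_pair_at.
  exact: (contC_cplx (continuous_comp continuous_sqn_w3 (@sqrt_continuous R _))
    (@cst_continuous _ _ 0 t0)).
apply: (continuous_phase_w continuous_sqn_w3 continuous_sqn_w4
  continuous_gram43) => [t|]; last by right.
have ht := set_valP t; split.
- exact: Mset_sqn_w3_ge0.
- exact: Mset_sqn_w4_ge0.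
- exact: Mset_sqnorm_gram43.
Qed.

Lemma continuous_w4_first : sqn_w4 (val t0) != 0 ->
  {for t0, continuous (fun t : M => w4_first (val t))}.
Proof.
move=> h; apply: continuous_pair_at; last first.
  exact: (contC_cplx (continuous_comp continuous_sqn_w4 (@sqrt_continuous R _))
    (@cst_continuous _ _ 0 t0)).
apply: (continuous_phase_w continuous_sqn_w4 continuous_sqn_w3
  (contC_conj continuous_gram43)) => [t|]; last by left.
have ht := set_valP t; split; [exact: Mset_sqn_w4_ge0|exact: Mset_sqn_w3_ge0|].
by rewrite sqnormJ mulrC; exact: Mset_sqnorm_gram43.
Qed.

Lemma continuous_section_conf s (hs : gram_section s) :
  {for t0, continuous (fun t : M => s (val t))} ->
  {for t0, continuous (fun t : M => section_conf hs (set_valP t))}.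
Proof.
move=> cs; apply: continuous_conf_of => i.
have c3 : {for t0, continuous (fun t : M => (s (val t)).1)}.
  exact: (continuous_comp cs (@cvg_fst _ _ _ _ _)).
have c4 : {for t0, continuous (fun t : M => (s (val t)).2)}.
  exact: (continuous_comp cs (@cvg_snd _ _ _ _ _)).
have c1 := @contC_cst R M t0 1.
case: i => [|[|[|[|i]]]].
- exact: cst_continuous.
- exact: cst_continuous.
- exact: (cont_vec3 continuous_std_z3 c3 c1).
- exact: (cont_vec3 continuous_std_z4 c4 c1).
(* Beyond the four lifts, [std] takes the default value 0, which is constant. *)
- apply: (@eq_continuous_at M t0 _ (fun=> 0 : 'cV[C]_3)); last exact: cst_continuous.
  by move=> t; rewrite /std nth_default.
Qed.

End AtPoint.

End Sections.

(* tau : Config -> C^2 x R is a homeomorphism onto Mset (with subspace topology):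
   it factors through a map f into the subspace Mset, and f is a homeomorphism. *)
Theorem theorem3p1 (R : realType) :
  exists f : Config R -> set_type (@Mset R),
    (forall c : Config R, val (f c) = tau c) /\
    exists g : set_type (@Mset R) -> Config R,
      [/\ cancel f g, cancel g f, continuous f & continuous g].
Proof.
have tauM (c : Config R) : Mset (tau c) := tau_quad_Mset (repr c).
pose f (c : Config R) : set_type (@Mset R) := SigSub (mem_set (tauM c)).
have tau_pi x : tau (\pi_(Config R) x)%qT = tau_quad x.
  have /(@eqmodP _ (pu_equiv R)) := reprK (\pi_(Config R) x)%qT.
  exact: tau_quad_pu_rel.
have tau_inj : injective (@tau R).
  move=> c c' /tau_quad_inj e; rewrite -[c]reprK -[c']reprK.
  exact/(@eqmodP _ (pu_equiv R)).
pose sec s (hs : gram_section s) (t : set_type (@Mset R)) : Config R :=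
  (\pi_(Config R) (section_conf hs (set_valP t)))%qT.
have tau_sec s (hs : gram_section s) t : tau (sec s hs t) = val t.
  by rewrite tau_pi tau_section_conf.
have sec_cont s (hs : gram_section s) (t : set_type (@Mset R)) :
    {for t, continuous (fun t : set_type (@Mset R) => s (val t))} ->
    {for t, continuous (sec s hs)}.
  move=> cs; have c := @continuous_section_conf R t s hs cs.
  exact: (continuous_comp c (@pi_continuous _ {eq_quot (@pu_rel R)}%qT _)).
(* Any section of the Gram data defines the inverse, since [tau] is injective. *)
exists f; split => //; exists (sec _ (@w3_first_gram R)); split.
- by move=> c; apply: tau_inj; rewrite tau_sec.
- by move=> t; apply: val_inj; rewrite /= tau_sec.
- by apply: continuous_comp_initial; exact: continuous_tau.
move=> t.
have [w4|w4] := eqVneq (sqn_w4 (val t)) 0.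
  by apply: sec_cont; exact: continuous_w3_first.
(* By injectivity of [tau] both sections induce the same map to [Config], so its continuity at [t]
   may be checked with the section that is continuous there. *)
apply: (@eq_continuous_at _ _ _ (sec _ (@w4_first_gram R))).
  by move=> t'; apply: tau_inj; rewrite !tau_sec.
by apply: sec_cont; exact: continuous_w4_first.
Qed.
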